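(* Let $\Omega\subset\mathbb{R}^2$ be a spatial domain with smooth boundary. Consider a smooth solution $(h,\mathbf u)$, with $h>0$, of the nonlinear rotating shallow water equations in vector invariant form $$\frac{\partial h}{\partial t}+\nabla\cdot\mathbf F=0,\qquad \frac{\partial\mathbf u}{\partial t}+\omega\mathbf u^\perp+\nabla G=\mathbf 0,$$ $$\mathbf F=h\mathbf u,\quad G=\tfrac12|\mathbf u|^2+gh,\quad \omega=\frac{\partial v}{\partial x}-\frac{\partial u}{\partial y}+f_c,$$ in $\Omega$ at subcritical flow ($|\mathbf u|<\sqrt{gh}$), with prescribed initial data $h|_{t=0}=h_0$, $\mathbf u|_{t=0}=\mathbf u_0$, subject to the homogeneous nonlinear boundary conditions $$\alpha G_n-\beta F_n=0\ \text{ and }\ u_s=0\quad\text{at points of }\partial\Omega\text{ where }u_n<0,$$ $$\alpha G_n-\beta F_n=0\quad\text{at points of }\partial\Omega\text{ where }u_n\ge0.$$ If $\alpha\ge0$, $\beta\ge0$ and $|\alpha|^2+|\beta|^2>0$, then the total energy/entropy $E(t)$ satisfies $$\frac{d}{dt}E(t)=\mathrm{BT}\le0,$$ and hence $E(t)\le E(0)$ for all $t\ge0$ (in the time interval on which the solution exists).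
   Context: Notation: $g>0$, $f_c$ constants; $\mathbf u=[u,v]^T$, $\mathbf u^\perp=[-v,u]^T$; $\mathbf n=[n_x,n_y]^T$ is the outward unit normal on $\partial\Omega$; $u_n=n_xu+n_yv$, $u_s=n_yu-n_xv$, $F_n=hu_n$, $G_n=\tfrac12u_n^2+gh$. The weights $\alpha,\beta$ are real and may depend on the boundary point and on the boundary values of the solution (nonlinear weights). Energy and boundary term: $$E(t)=\int_\Omega\Big(\tfrac12h|\mathbf u|^2+\tfrac12gh^2\Big)d\Omega,\qquad \mathrm{BT}=-\oint_{\partial\Omega}GF_n\,dS=-\oint_{\partial\Omega}\Big(F_nG_n+\tfrac12hu_nu_s^2\Big)dS.$$ *)

(* Defs.v *)
(* Points of the plane are pairs (x, y) : R * R, space-time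
   points are pairs (t, p) : R * (R * R); the topology is the product one. *)
From HB Require Import structures.
From mathcomp Require Import all_boot all_order all_algebra.
From mathcomp Require Import all_classical all_reals all_analysis.
From mathcomp Require Import ring.
Set Implicit Arguments.
Unset Strict Implicit.
Unset Printing Implicit Defensive.
Import Order.TTheory GRing.Theory Num.Theory.
Import numFieldNormedType.Exports.
Local Open Scope classical_set_scope.
Local Open Scope ring_scope.

Section smoothness.
Context {R : realType} {V W : normedModType R}.

(* All iterated directional derivatives of order at most n exist and are
   continuous at the points of U; for U open in a finite-dimensional V this is
   the usual class C^n. *)
Fixpoint class_C (n : nat) (U : set V) (f : V -> W) : Prop :=
  (forall x, U x -> {for x, continuous f}) /\
  (if n is k.+1 then
     forall v, (forall x, U x -> derivable f x v) /\
               class_C k U (fun x => 'D_v f x)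
   else True).

Definition smooth (U : set V) (f : V -> W) : Prop := forall n, class_C n U f.

(* Smoothness on a set that need not be open: f is the restriction of a smooth
   function defined on an open neighbourhood. *)
Definition smooth_upto (S : set V) (f : V -> W) : Prop :=
  exists (U : set V) (F : V -> W),
    [/\ open U, S `<=` U, smooth U F & forall x, S x -> F x = f x].

End smoothness.

Section plane.
Context {R : realType}.
Implicit Types (Omega : set (R * R)) (p q : R * R).

Definition dotp p q : R := p.1 * q.1 + p.2 * q.2.
(* The library norm on R * R is the maximum norm. *)
Definition enorm p : R := Num.sqrt (dotp p p).

Definition bdry Omega : set (R * R) := closure Omega `\` interior Omega.

(* Near p the set Omega is one side of the graph of a smooth function, up to
   relabelling and reorienting the coordinate axes. *)
Definition smooth_bdry_at Omega p : Prop :=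
  exists (r : R) (phi : R -> R), [/\ 0 < r, smooth setT phi &
    [\/ forall q, ball p r q -> (Omega q <-> phi q.1 < q.2),
        forall q, ball p r q -> (Omega q <-> q.2 < phi q.1),
        forall q, ball p r q -> (Omega q <-> phi q.2 < q.1) |
        forall q, ball p r q -> (Omega q <-> q.1 < phi q.2)]].

Definition smooth_domain Omega : Prop :=
  [/\ Omega !=set0, open Omega, connected Omega, bounded_set Omega &
      forall p, bdry Omega p -> smooth_bdry_at Omega p].

(* The boundary of a bounded smooth plane domain is a finite disjoint union of
   smooth closed curves: curve i is traversed once, regularly, by gamma i on
   [0, 1[ (in either direction). *)
Definition bdry_param Omega (m : nat) (gamma : 'I_m -> R -> R * R) : Prop :=
  [/\ forall i, smooth setT (gamma i),
      forall i s, gamma i (s + 1) = gamma i s,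
      forall i s, derive1 (gamma i) s != 0,
      forall i j s r, 0 <= s < 1 -> 0 <= r < 1 ->
        gamma i s = gamma j r -> i = j /\ s = r &
      forall p, bdry Omega p <-> exists i s, gamma i s = p].

Definition outward_unit_normal Omega (m : nat) (gamma : 'I_m -> R -> R * R)
    (n : R * R -> R * R) : Prop :=
  (forall i s, dotp (n (gamma i s)) (derive1 (gamma i) s) = 0) /\
  (forall p, bdry Omega p ->
     enorm (n p) = 1 /\ \forall r \near 0^'+, ~ Omega (p + r *: n p)).

(* Integral over the boundary with respect to arc length. *)
Definition oint (m : nat) (gamma : 'I_m -> R -> R * R) (f : R * R -> R) : R :=
  \sum_(i < m) \int[lebesgue_measure]_(s in `[0, 1])
     (f (gamma i s) * enorm (derive1 (gamma i) s)).

Definition area_integral Omega (f : R * R -> R) : R :=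
  \int[(@lebesgue_measure R \x @lebesgue_measure R)%E]_(p in Omega) f p.

Definition spacetime (T : \bar R) Omega : set (R * (R * R)) :=
  [set z | [/\ 0 <= z.1, (z.1%:E < T)%E & closure Omega z.2]].

Definition dx (f : R * R -> R) p : R := 'D_(1, 0) f p.
Definition dy (f : R * R -> R) p : R := 'D_(0, 1) f p.
Definition dt (f : R -> R * R -> R) (t : R) p : R := derive1 (f ^~ p) t.

End plane.

Section shallow_water.
Context {R : realType}.
Variables (g fc : R).
Implicit Types (Omega : set (R * R)) (h u v : R -> R * R -> R).

Definition potG (h u v : R) : R := (u ^+ 2 + v ^+ 2) / 2 + g * h.

Definition vorticity (u v : R * R -> R) (p : R * R) : R :=
  dx v p - dy u p + fc.

Definition sw_eqs h u v (t : R) (p : R * R) : Prop :=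
  let G q := potG (h t q) (u t q) (v t q) in
  let w := vorticity (u t) (v t) p in
  [/\ dt h t p + (dx (fun q => h t q * u t q) p +
                  dy (fun q => h t q * v t q) p) = 0,
      dt u t p - w * v t p + dx G p = 0 &
      dt v t p + w * u t p + dy G p = 0].

(* Below, n, h, u, v are the values at one boundary point. *)
Definition normal_vel (n : R * R) (u v : R) : R := n.1 * u + n.2 * v.
Definition tang_vel (n : R * R) (u v : R) : R := n.2 * u - n.1 * v.
Definition fluxFn (n : R * R) (h u v : R) : R := h * normal_vel n u v.
Definition potGn (n : R * R) (h u v : R) : R :=
  normal_vel n u v ^+ 2 / 2 + g * h.

Definition bdry_cond (a b : R) (n : R * R) (h u v : R) : Prop :=
  (normal_vel n u v < 0 ->
     a * potGn n h u v - b * fluxFn n h u v = 0 /\ tang_vel n u v = 0) /\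
  (0 <= normal_vel n u v ->
     a * potGn n h u v - b * fluxFn n h u v = 0).

Definition energy Omega h u v (t : R) : R :=
  area_integral Omega (fun p =>
    h t p * (u t p ^+ 2 + v t p ^+ 2) / 2 + g * h t p ^+ 2 / 2).

Definition bdry_term (m : nat) (gamma : 'I_m -> R -> R * R)
    (n : R * R -> R * R) h u v (t : R) : R :=
  - oint gamma (fun p =>
      potG (h t p) (u t p) (v t p) * fluxFn (n p) (h t p) (u t p) (v t p)).

Lemma bdry_termE Omega m (gamma : 'I_m -> R -> R * R) n h u v t :
  bdry_param Omega gamma -> outward_unit_normal Omega gamma n ->
  bdry_term gamma n h u v t =
  - oint gamma (fun p =>
      fluxFn (n p) (h t p) (u t p) (v t p) *
        potGn (n p) (h t p) (u t p) (v t p) +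
      h t p * normal_vel (n p) (u t p) (v t p) *
        tang_vel (n p) (u t p) (v t p) ^+ 2 / 2).
Proof.
move=> [_ _ _ _ im] [_ nrm]; rewrite /bdry_term /oint; congr (- _).
apply: eq_bigr => i _; apply: eq_Rintegral => s _; congr (_ * _).
have /nrm[n1 _] : bdry Omega (gamma i s) by apply/im; exists i, s.
have n2 : dotp (n (gamma i s)) (n (gamma i s)) = 1.
  rewrite -[LHS]sqr_sqrtr; last by rewrite addr_ge0// -expr2 sqr_ge0.
  by rewrite -[Num.sqrt _]/(enorm _) n1 expr1n.
move: n2; rewrite /potG /fluxFn /potGn /normal_vel /tang_vel /dotp.
set a := (n _).1; set b := (n _).2; set H := h _ _; set U := u _ _.
set W := v _ _ => n2.
have -> : U ^+ 2 + W ^+ 2 = (a * a + b * b) * (U ^+ 2 + W ^+ 2).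
  by rewrite n2 mul1r.
by field.
Qed.

End shallow_water.

(* Main.v *)
(** The unknowns extend to C^1 functions near the closure of Omega, so one may
differentiate under the integral; the equations turn the time derivative of the
energy density into minus the divergence of G (h u, h v), and the divergence
theorem gives dE/dt = BT.  The boundary condition makes G F_n nonnegative: at
inflow F_n <= 0 < G_n, so alpha G_n = beta F_n forces alpha = 0, hence beta > 0 and
F_n = 0; at outflow F_n >= 0 and G >= 0.

The divergence theorem is proved by localization.  For a C^1 function supported
in a small ball around a boundary point, Omega is one side of a graph
y = phi x; the fundamental theorem of calculus in the sheared coordinates
(x, y - phi x) leaves an integral over the graph, and the substitution given by
the boundary curve turns it into an arc length integral.  Finitely many cutoffs
reduce the general case to this one. *)

From HB Require Import structures.
Require Import Defs.
From mathcomp Require Import all_boot all_order all_algebra.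
From mathcomp Require Import all_classical all_reals all_analysis.
From mathcomp Require Import measurable_realfun ring lra.
Set Implicit Arguments.
Unset Strict Implicit.
Unset Printing Implicit Defensive.
Import Order.TTheory GRing.Theory Num.Theory.
Import numFieldNormedType.Exports.
Local Open Scope classical_set_scope.
Local Open Scope ring_scope.

(** * Calculus in one and two variables *)

(** [class_C] provides directional derivatives only, so the chain rule along a curve has to be
    recovered from C^1 regularity in the plane. The normal [n] is given pointwise, with no
    regularity: orthogonality to the curve, unit length and the outward condition determine it, and
    in a chart [n] times the speed of the curve is tau (phi', -1) |x'|. No square root is left in
    this product; it shows that the boundary integrands are continuous, and the absolute value
    absorbs the free orientation of the curves. The boundary curves are global whereas charts are
    local: injectivity modulo the period, together with compactness, shows that a small ball around
    a boundary point meets a single short arc. The fields are controlled only for 0 <= t < T on the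
    closure of [Omega], so derivatives at the edge of this set are those of the smooth extensions.
    On the boundary [h] is known to be nonnegative only, as a limit from inside. *)

Section one_variable.
Context {R : realType}.
Notation mu := (@lebesgue_measure R).

Lemma is_derive_continuous (F : R -> R) (x l : R) :
  is_derive x (1 : R) F l -> {for x, continuous F}.
Proof.
by move=> [dF _]; apply/differentiable_continuous/derivable1_diffP.
Qed.

Lemma continuous_integrable (f : R -> R) (a b : R) : continuous f ->
  mu.-integrable `[a, b] (EFin \o f).
Proof.
move=> cf; apply: continuous_compact_integrable; first exact: segment_compact.
exact: continuous_subspaceT.
Qed.

Lemma FTC2 (f F : R -> R) (a b : R) : a <= b -> continuous f ->
  {in `[a, b], forall x, is_derive x (1 : R) F (f x)} ->
  \int[mu]_(x in `[a, b]) f x = F b - F a.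
Proof.
rewrite le_eqVlt => /predU1P[->|ab] cf dF.
  by rewrite set_itv1 Rintegral_set1 subrr.
have cF x : x \in `[a, b] -> {for x, continuous F}.
  by move=> /dF /is_derive_continuous.
rewrite /Rintegral (@continuous_FTC2 _ f F)//.
- exact: continuous_subspaceT.
- split.
  + by move=> x xab; have [] := dF x (subset_itv_oo_cc xab).
  + by apply: cvg_at_right_filter; apply: cF; rewrite bound_itvE ltW.
  + by apply: cvg_at_left_filter; apply: cF; rewrite bound_itvE ltW.
- by move=> x xab; rewrite derive1E; have [] := dF x (subset_itv_oo_cc xab).
Qed.

(** The integral from [c] serves, and has a two-sided derivative only to the right of [c]; users
    take [c] below every point that they need. *)
Lemma primitive (f : R -> R) (c : R) : continuous f ->
  exists F : R -> R, forall x, c < x -> is_derive x (1 : R) F (f x).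
Proof.
move=> cf; exists (fun x => \int[mu]_(t in `[c, x]) f t) => x cx.
have [dF F'] := @continuous_FTC1_closed R f c x (x + 1) (ltr_pwDr ltr01 (lexx x))
  (continuous_integrable c (x + 1) cf) cx (cf x).
by apply: DeriveDef; [exact: dF|rewrite -derive1E; exact: F'].
Qed.

End one_variable.

Section plane_calculus.
Context {R : realType}.
Implicit Types (w : R * R -> R).

Lemma class_C1P {V W : normedModType R} (U : set V) (f : V -> W) :
  class_C 1 U f <->
  (forall x, U x -> {for x, continuous f}) /\
  forall v, (forall x, U x -> derivable f x v) /\
    (forall x, U x -> {for x, continuous ('D_v f)}).
Proof.
split=> -[cf H]; split => // v; have [Hd Hc] := H v; split => //.
  by have [] := Hc.
Qed.

Lemma is_derive_slice {V W : normedModType R} (f : V -> W) (p v : V) (s : R) :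
  derivable f (s *: v + p) v ->
  is_derive s 1 (fun r : R => f (r *: v + p)) ('D_v f (s *: v + p)).
Proof.
have E : (fun h : R => h^-1 *: (f ((h *: (1 : R) + s) *: v + p) - f (s *: v + p)))
   = (fun h : R => h^-1 *: (f (h *: v + (s *: v + p)) - f (s *: v + p))).
  by apply/funext => h; rewrite scalerDl addrA [_ *: 1]mulr1.
by move=> df; apply: DeriveDef; rewrite /derivable /derive E.
Qed.

Lemma is_derive_fst w (x y : R) : derivable w (x, y) (1, 0) ->
  is_derive x 1 (fun r : R => w (r, y)) (dx w (x, y)).
Proof.
have E (r : R) : (r, y) = r *: (1, 0) + (0, y) :> R * R.
  by congr pair; rewrite /= ?[_ *: _]mulr1 ?[_ *: _]mulr0 ?addr0 ?add0r.
under eq_fun do rewrite E.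
by rewrite {1 2}E; exact: is_derive_slice.
Qed.

Lemma is_derive_snd w (x y : R) : derivable w (x, y) (0, 1) ->
  is_derive y 1 (fun r : R => w (x, r)) (dy w (x, y)).
Proof.
have E (r : R) : (x, r) = r *: (0, 1) + (x, 0) :> R * R.
  by congr pair; rewrite /= ?[_ *: _]mulr1 ?[_ *: _]mulr0 ?addr0 ?add0r.
under eq_fun do rewrite E.
by rewrite {1 2}E; exact: is_derive_slice.
Qed.

(** The increment [k] may have either sign, which suits increments that range over a ball. *)
Lemma MVT_dist (f df : R -> R) (x k : R) :
  (forall y, `|y - x| <= `|k| -> is_derive y 1 f (df y)) ->
  exists2 c, `|c - x| <= `|k| & f (x + k) - f x = df c * k.
Proof.
move=> dfP; have [k0|/ltW k0] := leP 0 k.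
  have [|||c] := @MVT_segment _ f df x (x + k).
  - by rewrite lerDl.
  - move=> y; rewrite in_itv/= => /andP[xy yk]; apply: dfP.
    by rewrite !ger0_norm//; lra.
  - apply: derivable_within_continuous => y; rewrite in_itv/= => /andP[xy yk].
    have [] // := dfP y _.
    by rewrite !ger0_norm//; lra.
  rewrite in_itv/= => /andP[xc ck] ->; exists c; last by congr (_ * _); lra.
  by rewrite !ger0_norm//; lra.
have [|||c] := @MVT_segment _ f df (x + k) x.
- by rewrite gerDl.
- move=> y; rewrite in_itv/= => /andP[xy yk]; apply: dfP.
  by rewrite !ler0_norm//; lra.
- apply: derivable_within_continuous => y; rewrite in_itv/= => /andP[xy yk].
  have [] // := dfP y _.
  by rewrite !ler0_norm//; lra.
rewrite in_itv/= => /andP[xc ck] E; exists c.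
  by rewrite !ler0_norm//; lra.
by rewrite -opprB E; ring.
Qed.

Lemma prod_ball (p q : R * R) (e : R) :
  ball p e q <-> `|p.1 - q.1| < e /\ `|p.2 - q.2| < e.
Proof. by []. Qed.

Lemma linear_approx_differentiable {V W : normedModType R} (f : V -> W)
    (L : {linear V -> W}) (x : V) : continuous L ->
  (forall e, 0 < e ->
     \forall k \near 0, `|f (k + x) - (f x + L k)| <= e * `|k|) ->
  differentiable f x.
Proof.
move=> cL fL.
have fLo : f \o shift x = cst (f x) + L +o_ 0 id.
  by apply/eqaddoP => e e0; exact: fL.
by apply/diff_locallyP; rewrite (diff_unique cL fLo).
Qed.

(** The increment is split into a horizontal and a vertical one. The mean value theorem turns each
    into a partial derivative at a nearby point, and continuity of the partials makes the error
    small compared with the increment. The chain rule needs this total derivative. *)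
Lemma class_C1_differentiable (U : set (R * R)) w (p : R * R) :
  open U -> U p -> class_C 1 U w -> differentiable w p.
Proof.
move=> oU Up /class_C1P[cw dw].
pose L (k : R * R) := dx w p * k.1 + dy w p * k.2.
have Llin : linear L.
  move=> a [k1 k2] [l1 l2].
  change (dx w p * (a * k1 + l1) + dy w p * (a * k2 + l2) =
    a * (dx w p * k1 + dy w p * k2) + (dx w p * l1 + dy w p * l2)).
  by ring.
pose HL := GRing.isLinear.Build _ _ _ _ _ Llin.
pose Ll : {linear (R * R)%type -> R} := HB.pack L HL.
have cL : continuous Ll.
  move=> k; apply: (@cvgD _ _ _ _ _ (fun k : R * R => _) (fun k : R * R => _)).
    by apply: cvgMr; apply: cvg_fst.
  by apply: cvgMr; apply: cvg_snd.
apply: (linear_approx_differentiable cL) => e e0.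
have e20 : 0 < e / 2 by rewrite divr_gt0.
have N : \forall q \near p, [/\ U q, `|dx w p - dx w q| <= e / 2 &
    `|dy w p - dy w q| <= e / 2].
  have NU : nbhs p U by exact: open_nbhs_nbhs.
  have [_ cdx] := dw (1, 0); have [_ cdy] := dw (0, 1).
  have Nx : \forall q \near p, `|dx w p - dx w q| <= e / 2.
    exact: (@cvgr_dist_le _ _ _ _ _ _ _ (cdx p Up) _ e20).
  have Ny : \forall q \near p, `|dy w p - dy w q| <= e / 2.
    exact: (@cvgr_dist_le _ _ _ _ _ _ _ (cdy p Up) _ e20).
  apply: (@filterS _ (nbhs p) _ _ _ _ (filterI NU (filterI Nx Ny))).
  by move=> q [Uq [xq yq]]; split; [exact: Uq|exact: xq|exact: yq].
move/nbhs_ballP : N => [d /= d0 N].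
apply/nbhs_ballP; exists d => //= -[a b] /prod_ball /=.
rewrite !sub0r !normrN => -[ad bd].
(* Balls of the maximum norm are squares, so both legs of the path from [p] to [p + (a, b)] stay
   where the estimates hold. *)
have Np (q : R * R) : `|q.1 - p.1| <= `|a| -> `|q.2 - p.2| <= `|b| ->
    [/\ U q, `|dx w p - dx w q| <= e / 2 & `|dy w p - dy w q| <= e / 2].
  by move=> qa qb; apply: N; apply/prod_ball; rewrite distrC (le_lt_trans qa)//
    distrC (le_lt_trans qb).
have [c ca E1] : exists2 c, `|c - p.1| <= `|a| &
    w (p.1 + a, p.2 + b) - w (p.1, p.2 + b) = dx w (c, p.2 + b) * a.
  apply: (@MVT_dist (fun r => w (r, p.2 + b)) (fun r => dx w (r, p.2 + b))).
  move=> y ya; apply: is_derive_fst; case: (dw (1, 0)) => + _; apply.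
  by have [] // := Np (y, p.2 + b) _ _; rewrite /= addrAC subrr add0r.
have [c' cb E2] : exists2 c, `|c - p.2| <= `|b| &
    w (p.1, p.2 + b) - w (p.1, p.2) = dy w (p.1, c) * b.
  apply: (@MVT_dist (fun r => w (p.1, r)) (fun r => dy w (p.1, r))).
  move=> y ya; apply: is_derive_snd; case: (dw (0, 1)) => + _; apply.
  by have [] // := Np (p.1, y) _ _; rewrite /= subrr normr0.
have [_ B1 _] : [/\ U (c, p.2 + b), `|dx w p - dx w (c, p.2 + b)| <= e / 2 &
    `|dy w p - dy w (c, p.2 + b)| <= e / 2].
  by apply: Np; rewrite /= ?(addrAC _ b) ?subrr ?add0r.
have [_ _ B2] : [/\ U (p.1, c'), `|dx w p - dx w (p.1, c')| <= e / 2 &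
    `|dy w p - dy w (p.1, c')| <= e / 2].
  by apply: Np; rewrite /= ?subrr ?normr0.
have -> : w ((a, b) + p) - (w p + Ll (a, b)) =
    (dx w (c, p.2 + b) - dx w p) * a + (dy w (p.1, c') - dy w p) * b.
  rewrite /= /L /=.
  have -> : (a, b) + p = (p.1 + a, p.2 + b).
    by rewrite [p in LHS]surjective_pairing; congr pair; rewrite /= addrC.
  rewrite [X in _ - (w X + _)]surjective_pairing /=.
  move: E1 E2; lra.
have na : `|a| <= `|(a, b)| by rewrite prod_normE /= le_max lexx.
have nb : `|b| <= `|(a, b)| by rewrite prod_normE /= le_max lexx orbT.
rewrite (le_trans (ler_normD _ _))// !normrM (splitr e) mulrDl.
by rewrite lerD// ler_pM// distrC.
Qed.

Lemma is_derive_comp2 (U : set (R * R)) w (f g : R -> R) (x f' g' : R) :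
  open U -> U (f x, g x) -> class_C 1 U w ->
  is_derive x 1 f f' -> is_derive x 1 g g' ->
  is_derive x 1 (fun t => w (f t, g t))
    (dx w (f x, g x) * f' + dy w (f x, g x) * g').
Proof.
move=> oU Ux wC [df <-] [dg <-].
have dw := class_C1_differentiable oU Ux wC.
have dfx : differentiable f x by exact/derivable1_diffP.
have dgx : differentiable g x by exact/derivable1_diffP.
have dfg : differentiable (fun t => (f t, g t)) x by exact: differentiable_pair.
have dc : differentiable (w \o (fun t => (f t, g t))) x.
  exact: differentiable_comp.
apply: DeriveDef; first exact/derivable1_diffP.
rewrite /dx /dy (@deriveE _ _ _ w _ (1, 0))// (@deriveE _ _ _ w _ (0, 1))//.
rewrite [LHS](deriveE _ dc) diff_comp//= diff_pair//= -(deriveE _ dfx) -(deriveE _ dgx).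
set A := 'D_1 f x; set B := 'D_1 g x.
have -> : (A, B) = A *: (1, 0) + B *: (0, 1) :> R * R.
  change ((A, B) = (A * 1 + B * 0, A * 0 + B * 1)).
  by rewrite !mulr1 !mulr0 addr0 add0r.
by rewrite linearD !linearZ /= ![_ *: _]mulrC.
Qed.

End plane_calculus.

(** * Integration over plane domains *)

Section plane_measure.
Context {R : realType}.
Notation mu := (@lebesgue_measure R).
Notation mu2 := (mu \x mu)%E.
Implicit Types (D : set (R * R)) (f : R * R -> R).

(** Measurability refers to the product sigma-algebra, so an open set is written as a countable
    union of boxes with rational centres and radii 1/(n+1). *)
Lemma open_measurable2 D : open D -> measurable D.
Proof.
move=> oD.
pose B (k : rat * rat * nat) : set (R * R) :=
  ball (ratr k.1.1 : R) k.2.+1%:R^-1 `*` ball (ratr k.1.2 : R) k.2.+1%:R^-1.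
have mB k : measurable (B k).
  by apply: measurableX; apply: open_measurable; exact: ball_open.
have -> : D = \bigcup_(k in [set k | B k `<=` D]) B k.
  apply/seteqP; split => [p Dp|p [k /= + Bp]]; last exact.
  have /nbhs_ballP[e /= e0 eD] : nbhs p D by exact: open_nbhs_nbhs.
  have [n _ ne] : \forall n \near \oo, n.+1%:R^-1 < e / 2.
    have e20 : 0 < e / 2 by rewrite divr_gt0.
    exact: (near_infty_natSinv_lt (PosNum e20)).
  pose d : R := n.+1%:R^-1.
  have d0 : 0 < d by rewrite invr_gt0.
  have de : d < e / 2 by apply: ne => /=.
  have [q1] : exists q : rat, ratr q \in `]p.1, p.1 + d[.
    by apply: rat_in_itvoo; rewrite ltrDl.
  rewrite in_itv/= => /andP[q1l q1r].
  have [q2] : exists q : rat, ratr q \in `]p.2, p.2 + d[.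
    by apply: rat_in_itvoo; rewrite ltrDl.
  rewrite in_itv/= => /andP[q2l q2r].
  exists (q1, q2, n) => [q|]; rewrite /B /ball /= -/d; last first.
    by rewrite !gtr0_norm ?subr_gt0//; split; lra.
  move=> -[qq1 qq2]; apply: eD; apply/prod_ball.
  have q1p : `|p.1 - ratr q1| < d by rewrite ltr0_norm ?subr_lt0//; lra.
  have q2p : `|p.2 - ratr q2| < d by rewrite ltr0_norm ?subr_lt0//; lra.
  split.
    rewrite (le_lt_trans (ler_distD (ratr q1) _ _))//.
    by rewrite (splitr e) ltrD// (lt_trans _ de).
  rewrite (le_lt_trans (ler_distD (ratr q2) _ _))//.
  by rewrite (splitr e) ltrD// (lt_trans _ de).
rewrite bigcup_mkcond; apply: countable_bigcupT_measurable => // k.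
by case: ifP.
Unshelve. all: by end_near. Qed.

Lemma continuous_measurable2 D f : open D ->
  (forall p, D p -> {for p, continuous f}) -> measurable_fun D f.
Proof.
move=> oD cf; apply: (measurability _ (RGenOpens.measurableE R)).
move=> _ [_ [a [b ->] <-]]; apply: open_measurable2.
rewrite openE => p [Dp fp]; apply: filterI; first exact: open_nbhs_nbhs.
apply: cf => //; apply: open_nbhs_nbhs; split => //; exact: interval_open.
Qed.

Lemma bounded_set_finite D : measurable D -> bounded_set D -> (mu2 D < +oo)%E.
Proof.
move=> mD /pinfty_ex_gt0[M M0 DM].
have DB : D `<=` `[- M, M] `*` `[- M, M].
  move=> p /DM/=; rewrite prod_normE /= ge_max => /andP[p1 p2].
  by split; rewrite /= in_itv /= -ler_norml.
apply: (@le_lt_trans _ _ (mu2 (`[- M, M] `*` `[- M, M]))).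
  by apply: le_measure => //; rewrite inE//; exact: measurableX.
rewrite product_measure1E//= !lebesgue_measure_itv/=.
by case: ifPn => _; rewrite ?mul0e// -EFinM ltry.
Qed.

Lemma bounded_integrable2 D f (M : R) : measurable D -> bounded_set D ->
  measurable_fun D f -> (forall p, D p -> `|f p| <= M) ->
  mu2.-integrable D (EFin \o f).
Proof.
move=> mD bD mf fM; apply: measurable_bounded_integrable => //.
  exact: bounded_set_finite.
by exists M; split=> [|x Mx p Dp]; rewrite ?num_real//= (le_trans (fM _ Dp))// ltW.
Qed.

Definition compactly_supported f := exists M, forall p, M < `|p| -> f p = 0.

Lemma ball0_compact (M : R) : compact [set p : R * R | `|p| <= M].
Proof.
have -> : [set p : R * R | `|p| <= M] = `[- M, M] `*` `[- M, M].
  apply/seteqP; split => -[x y]; rewrite /= prod_normE /= !in_itv/= ge_max !ler_norml.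
    by move=> /andP[].
  by move=> [-> ->].
by apply: compact_setX; exact: segment_compact.
Qed.

Lemma compact_norm_bounded (T : topologicalType) (K : set T) (f : T -> R) :
  compact K -> (forall p, K p -> {for p, continuous f}) ->
  exists M, forall p, K p -> `|f p| <= M.
Proof.
move=> cK cf.
have cfK : {within K, continuous f}.
  by apply: continuous_in_subspaceT => p; rewrite inE; exact: cf.
have /compact_bounded/pinfty_ex_gt0[M M0 fM] := continuous_compact cfK cK.
by exists M => p Kp; apply: fM; exists p.
Qed.

Lemma compactly_supported_bounded f : continuous f -> compactly_supported f ->
  exists M, forall p, `|f p| <= M.
Proof.
move=> cf [M fM].
have [N fN] := compact_norm_bounded (@ball0_compact M) (fun p _ => cf p).
exists (Num.max N 0) => p; rewrite le_max.
have [pM|Mp] := leP `|p| M; first by rewrite fN.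
by rewrite fM// normr0 lexx orbT.
Qed.

Lemma integrable_csupp D f : measurable D -> continuous f ->
  compactly_supported f -> mu2.-integrable D (EFin \o f).
Proof.
move=> mD cf sf; have [N fN] := compactly_supported_bounded cf sf.
have [M fM] := sf; apply: (@integrableS _ _ _ mu2 setT) => //.
pose K := [set p : R * R | `|p| <= M].
have mK : measurable K.
  rewrite -[K]setCK; apply: measurableC; apply: open_measurable2.
  apply: closed_openC; apply: compact_closed; last exact: ball0_compact.
  exact: norm_hausdorff.
have mf : measurable_fun setT f.
  apply: continuous_measurable2 => [|p _]; last exact: cf.
  by change (open [set: R * R]); exact: openT.
have -> : EFin \o f = (EFin \o f) \_ K.
  apply/funext => p; rewrite patchE; case: ifPn => //.
  by rewrite notin_setE /K /= => /negP; rewrite -ltNge => /fM /= ->.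
apply: (iffLR (@integrable_mkcond _ _ _ mu2 K _ mK)).
apply: (@bounded_integrable2 _ _ N) => //.
- exists M; split; rewrite ?num_real// => x Mx p /= pM.
  by rewrite (le_trans pM)// ltW.
- exact: measurable_funTS.
Qed.

(* Both orders of integration, which treat graphs over either axis alike. *)
Lemma area_integral_iterated D f : measurable D -> continuous f ->
  compactly_supported f ->
  [/\ mu.-integrable setT (EFin \o (fun x => \int[mu]_y (f \_ D) (x, y))),
      area_integral D f = \int[mu]_x \int[mu]_y (f \_ D) (x, y) &
      area_integral D f = \int[mu]_y \int[mu]_x (f \_ D) (x, y)].
Proof.
move=> mD cf sf.
have iD : mu2.-integrable setT (EFin \o (f \_ D)).
  have := integrable_csupp mD cf sf => /(iffLR (@integrable_mkcond _ _ _ mu2 D _ mD)).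
  by rewrite restrict_EFin.
have [N fN] := compactly_supported_bounded cf sf.
have [M fM] := sf.
have mfD : measurable_fun setT (f \_ D) by apply/measurable_EFinP; exact: measurable_int iD.
have fDM p : M < `|p| -> (f \_ D) p = 0.
  by move=> /fM fp; rewrite patchE fp; case: ifP.
have fDN p : `|(f \_ D) p| <= N.
  by rewrite patchE; case: ifP => // _; rewrite normr0 (le_trans _ (fN p)).
have I1 (k : R -> R) : measurable_fun setT k -> (forall y, M < `|y| -> k y = 0) ->
    (forall y, `|k y| <= N) -> mu.-integrable setT (EFin \o k).
  move=> mk k0 kN.
  have -> : EFin \o k = (EFin \o k) \_ `[- M, M].
    apply/funext => y; rewrite patchE; case: ifPn => //.
    by rewrite notin_setE /= in_itv/= -ler_norml => /negP; rewrite -ltNge => /k0 /= ->.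
  have mI : measurable (`[- M, M]%classic : set R) by exact: measurable_itv.
  apply: (iffLR (@integrable_mkcond _ _ _ mu _ _ mI)).
  apply: measurable_bounded_integrable => //.
  - by rewrite /= lebesgue_measure_itv/=; case: ifPn => _; rewrite ?ltry// -EFinB ltry.
  - exact: measurable_funTS.
  - by exists N; split=> [|x Mx p Dp]; rewrite ?num_real//= (le_trans (kN _))// ltW.
have H1 x : mu.-integrable setT (EFin \o (fun y => (f \_ D) (x, y))).
  apply: I1 => // [|y My].
    by apply: measurableT_comp => //; exact: measurable_pair1.
  by apply: fDM; rewrite prod_normE /= lt_max My orbT.
have H2 y : mu.-integrable setT (EFin \o (fun x => (f \_ D) (x, y))).
  apply: I1 => // [|x Mx].
    by apply: measurableT_comp => //; exact: measurable_pair2.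
  by apply: fDM; rewrite prod_normE /= lt_max Mx.
(* Fubini is stated with extended real inner integrals; every slice is integrable, so passing to
   real values loses nothing. *)
have F1 : EFin \o (fun x => \int[mu]_y (f \_ D) (x, y)) =
    fubini_F mu (EFin \o (f \_ D)).
  apply/funext => x; rewrite /fubini_F /= /Rintegral fineK//.
  exact: (integrable_fin_num _ (H1 x)).
have F2 : EFin \o (fun y => \int[mu]_x (f \_ D) (x, y)) =
    fubini_G mu (EFin \o (f \_ D)).
  apply/funext => y; rewrite /fubini_G /= /Rintegral fineK//.
  exact: (integrable_fin_num _ (H2 y)).
split; first by rewrite F1; exact: integrable_fubini_F.
- rewrite /area_integral Rintegral_mkcond; congr fine.
  have /= -> := congr1 (fun k => \int[mu]_x k x)%E F1.
  exact/esym/(integral12_prod_meas1 iD).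
- rewrite /area_integral Rintegral_mkcond; congr fine.
  have /= -> := congr1 (fun k => \int[mu]_x k x)%E F2.
  exact/esym/(integral21_prod_meas1 iD).
Qed.

End plane_measure.

(** * Integrals of partial derivatives beside a graph *)

Section graph.
Context {R : realType}.
Notation mu := (@lebesgue_measure R).
Implicit Types (w f : R * R -> R).

Lemma continuous_pair_at {T U V : topologicalType} (f : T -> U) (g : T -> V)
    (x : T) : {for x, continuous f} -> {for x, continuous g} ->
  {for x, continuous (fun y => (f y, g y))}.
Proof. by move=> cf cg; exact: (cvg_pair cf cg). Qed.

Lemma continuous_fst_comp (k : R -> R) : continuous k ->
  continuous (fun p : R * R => k p.1).
Proof.
by move=> ck p; apply: (@continuous_comp _ _ _ fst k) (ck _); exact: cvg_fst.
Qed.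

Lemma Rintegral_vanish (k : R -> R) (M : R) :
  (forall x, M < `|x| -> k x = 0) ->
  \int[mu]_x k x = \int[mu]_(x in `[- M, M]) k x.
Proof.
move=> k0; rewrite [RHS]Rintegral_mkcond; apply: eq_Rintegral => x _.
rewrite patchE; case: ifPn => //; rewrite notin_setE /= in_itv/= -ler_norml.
by move=> /negP; rewrite -ltNge => /k0.
Qed.

Lemma vanish_derive w (M : R) (v : R * R) : (forall p, M < `|p| -> w p = 0) ->
  forall p, M < `|p| -> 'D_v w p = 0.
Proof.
move=> w0 p Mp; rewrite (@near_eq_derive _ _ _ w (cst 0) p v) ?derive_cst//.
near=> q; apply: w0; near: q.
by apply: (cvgr_norm_gt p) => //; exact: cvg_id.
Unshelve. all: by end_near. Qed.

Lemma is_derive_vertical w (x y : R) : class_C 1 setT w ->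
  is_derive y 1 (fun r => w (x, r)) (dy w (x, y)).
Proof.
by move=> /class_C1P[_ dw]; apply: is_derive_snd; case: (dw (0, 1)) => + _; exact.
Qed.

Lemma class_C1_continuous_derive w (v : R * R) : class_C 1 setT w ->
  continuous ('D_v w).
Proof. by move=> /class_C1P[_ dw] p; case: (dw v) => _; exact. Qed.

(* [tau] is 1 or -1: integration over the ray beyond [c] in direction [tau]. *)
Lemma Rintegral_ray (k K : R -> R) (tau c M N : R) :
  tau = 1 \/ tau = -1 -> continuous k -> (forall y, M < `|y| -> k y = 0) ->
  M < N -> `|c| <= N ->
  (forall y : R, `|y| <= N -> is_derive y 1 K (k y)) ->
  \int[mu]_y (k \_ [set y | 0 < tau * (y - c)]) y = tau * (K (tau * N) - K c).
Proof.
move=> tau1 ck k0 MN; rewrite ler_norml => /andP[cN1 cN2] dK.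
have dK' a b : - N <= a -> b <= N ->
    {in `[a, b], forall x : R, is_derive x 1 K (k x)}.
  move=> Na bN x; rewrite in_itv/= => /andP[ax xb]; apply: dK.
  by rewrite ler_norml (le_trans Na)// (le_trans xb).
case: tau1 => ->.
(* [k] vanishes beyond [N], so the ray can be cut to a bounded interval. *)
- have -> : k \_ [set y | 0 < 1 * (y - c)] = k \_ `]c, N].
    apply/funext => y; rewrite !patchE.
    have [Ny|yN] := ltP N y; first
      by rewrite k0 ?if_same// (lt_trans MN)// (lt_le_trans Ny)// ler_norm.
    by congr (if _ then _ else _); apply/idP/idP;
      rewrite !inE/= in_itv/= yN andbT mul1r subr_gt0.
  rewrite -Rintegral_mkcond Rintegral_itv_obnd_cbnd; last first.
    apply: integrableS (continuous_integrable c N ck) => //.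
    exact: subset_itv_oc_cc.
  rewrite !mul1r (FTC2 cN2 ck (dK' _ _ cN1 (lexx _)))//.
- have -> : k \_ [set y | 0 < -1 * (y - c)] = k \_ `[- N, c[.
    apply/funext => y; rewrite !patchE.
    have [Ny|yN] := ltP y (- N).
      rewrite k0 ?if_same// (lt_trans MN)// -normrN (lt_le_trans _ (ler_norm _))//.
      by rewrite ltrNr.
    by congr (if _ then _ else _); apply/idP/idP;
      rewrite !inE/= in_itv/= yN/= mulN1r oppr_gt0 subr_lt0.
  rewrite -Rintegral_mkcond Rintegral_itv_bndo_bndc; last first.
    apply: integrableS (continuous_integrable (- N) c ck) => //.
    exact: subset_itv_co_cc.
  by rewrite !mulN1r (FTC2 cN1 ck (dK' _ _ (lexx _) cN2)) opprB.
Qed.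

Variables (phi phi' : R -> R) (tau : R).
Hypothesis tau1 : tau = 1 \/ tau = -1.
Hypothesis dphi : forall x : R, is_derive x 1 phi (phi' x).
Hypothesis cphi' : continuous phi'.
Let S : set (R * R) := [set q | 0 < tau * (q.2 - phi q.1)].

Let cphi : continuous phi.
Proof. by move=> x; exact: is_derive_continuous (dphi x). Qed.

Variables (w : R * R -> R) (M : R).
Hypothesis wC : class_C 1 setT w.
Hypothesis w0 : forall p, M < `|p| -> w p = 0.

Let section_out (x y : R) : M < `|y| -> M < `|(x, y)|.
Proof. by move=> My; rewrite prod_normE lt_max My orbT. Qed.

Let section_outl (x y : R) : M < `|x| -> M < `|(x, y)|.
Proof. by move=> My; rewrite prod_normE lt_max My. Qed.

Let cw : continuous w.
Proof. by have /class_C1P[cw _] := wC => p; exact: cw. Qed.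

Let continuous_section f (x : R) : continuous f -> continuous (fun y => f (x, y)).
Proof.
move=> cf y; apply: (@continuous_comp _ _ _ (fun y => (x, y)) f) (cf _).
by apply: continuous_pair_at; [exact: cvg_cst|exact: cvg_id].
Qed.

Let section_patch f (x : R) : (fun y => (f \_ S) (x, y)) =
  (fun y => f (x, y)) \_ [set y | 0 < tau * (y - phi x)].
Proof. by apply/funext. Qed.

(** Each vertical section of the region is a ray starting at [phi x]. The fundamental theorem leaves
    the value of [w] at the graph, since [w] vanishes at the far end. *)
Lemma graph_integral_dy :
  \int[mu]_x \int[mu]_y ((dy w) \_ S) (x, y) =
  \int[mu]_(x in `[- M, M]) (- tau * w (x, phi x)).
Proof.
rewrite -Rintegral_vanish; last by move=> x Mx; rewrite w0 ?mulr0// section_outl.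
apply: eq_Rintegral => x _.
pose N := `|M| + `|phi x| + 1.
have MN : M < N by rewrite /N; have := ler_norm M; have := normr_ge0 (phi x); lra.
have pN : `|phi x| <= N by rewrite /N; have := normr_ge0 M; lra.
rewrite -[RHS](_ : tau * (w (x, tau * N) - w (x, phi x)) = _); last first.
  rewrite w0 ?sub0r ?mulrN ?mulNr//; apply: section_out.
  rewrite normrM (_ : `|tau| = 1) ?mul1r ?(lt_le_trans MN) ?ler_norm//.
  by case: tau1 => ->; rewrite ?normrN normr1.
rewrite section_patch; apply: (@Rintegral_ray _ (fun y => w (x, y)) _ _ M) => //.
- by apply: continuous_section; exact: class_C1_continuous_derive.
- by move=> y My; apply: vanish_derive (section_out _ My); exact: w0.
- by move=> y _; exact: is_derive_vertical.
Qed.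

(* In the coordinates (x, z) with z = y - phi x the region is a half plane and
   [dx w] is the x-derivative of the sheared function minus [phi' * dy w]. *)
Lemma graph_integral_dx :
  \int[mu]_x \int[mu]_y ((dx w) \_ S) (x, y) =
  \int[mu]_(x in `[- M, M]) (tau * (phi' x * w (x, phi x))).
Proof.
pose sh (p : R * R) : R * R := (p.1, p.2 + phi p.1).
(* By the chain rule [g] is the x-derivative of [w \o sh]. *)
pose g p := dx w (sh p) + phi' p.1 * dy w (sh p).
pose H : set (R * R) := [set q | 0 < tau * q.2].
have csh : continuous sh.
  move=> p; apply: continuous_pair_at; first exact: cvg_fst.
  apply: cvgD; first exact: cvg_snd.
  exact: (continuous_fst_comp cphi).
have cD v : continuous (fun p => 'D_v w (sh p)).
  move=> p; apply: (@continuous_comp _ _ _ sh ('D_v w)) (csh p) _.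
  exact: class_C1_continuous_derive.
have cg : continuous g.
  move=> p; apply: cvgD; first exact: cD.
  apply: cvgM; last exact: cD.
  exact: (continuous_fst_comp cphi').
have D0 v p : M < `|p| -> 'D_v w p = 0 by exact: vanish_derive.
have [B phiB] := compact_norm_bounded (@segment_compact R (- M) M)
  (fun x _ => @cphi x).
have sg : compactly_supported g.
  exists (`|M| + `|B|) => -[x z]; rewrite prod_normE/= lt_max /g /sh /= => xz.
  have Bx : `|B| >= 0 by [].
  have [Mx|xM] := ltP M `|x|; first by rewrite /dx /dy !D0 ?mulr0 ?addr0// section_outl.
  have px : `|phi x| <= `|B|.
    by rewrite (le_trans (phiB _ _)) ?ler_norm//= in_itv/= -ler_norml.
  have zb : `|M| + `|B| < `|z|.
    by case/orP: xz => // xz; have := ler_norm M; lra.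
  rewrite /dx /dy !D0 ?mulr0 ?addr0//; apply: section_out;
  have := lerB_normD z (phi x); have := ler_norm M; lra.
have mH : measurable H.
  apply: open_measurable2; rewrite (_ : H = snd @^-1` [set y | 0 < tau * y])//.
  apply: open_comp; first by move=> p _; exact: cvg_snd.
  rewrite (_ : mkset _ = ( *%R tau) @^-1` [set y | 0 < y])//.
  apply: open_comp; last exact: open_gt.
  by move=> p _; exact: mulrl_continuous.
have J x : \int[mu]_y ((dx w) \_ S) (x, y) =
    \int[mu]_z (g \_ H) (x, z) + tau * (phi' x * w (x, phi x)).
  pose N := `|M| + `|phi x| + `|phi x| + 1.
  have p0 := normr_ge0 (phi x); have M0 := normr_ge0 M; have MM := ler_norm M.
  have cdx : continuous (fun y => dx w (x, y)).
    by apply: continuous_section; exact: class_C1_continuous_derive.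
  (* Both uses of [P] concern points of absolute value at most [N + |phi x|], which is less than
     [N + N]. *)
  have [P dP] := primitive (- (N + N)) cdx.
  (* A primitive of [g (x, z)] in [z]: the term with [dy w] integrates explicitly and gives the
     contribution of the graph. *)
  pose K z := P (z + phi x) + phi' x * w (x, z + phi x).
  have tn : `|tau| = 1 by case: tau1 => ->; rewrite ?normrN normr1.
  have tt : tau * tau = 1 by case: tau1 => ->; rewrite ?mulrNN mulr1.
  have tphi : `|tau * phi x| = `|phi x| by rewrite normrM tn mul1r.
  have tphi1 : - `|phi x| <= tau * phi x <= `|phi x| by rewrite -tphi -ler_norml.
  (* The far ends correspond under the shear: z = [tau * N] is y = [tau * N']. The values of [P]
     there then cancel. *)
  pose N' := N + tau * phi x.
  have N'E : tau * N' = tau * N + phi x by rewrite /N' mulrDr mulrA tt mul1r.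
  have N'0 : 0 < N' by rewrite /N' /N; lra.
  have -> : \int[mu]_y ((dx w) \_ S) (x, y) = tau * (P (tau * N') - P (phi x)).
    rewrite section_patch; apply: (@Rintegral_ray _ P _ _ M) => //.
    - by move=> y My; exact/D0/section_out.
    - by rewrite /N' /N; lra.
    - by rewrite /N' /N; lra.
    - move=> y yN; apply: dP; move: yN; rewrite ler_norml => /andP[].
      by rewrite /N' /N; lra.
  have -> : (fun z => (g \_ H) (x, z)) =
      (fun z => g (x, z)) \_ [set z | 0 < tau * (z - 0)].
    by apply/funext => z; rewrite !patchE; congr (if _ then _ else _);
      apply/idP/idP; rewrite !inE/= subr0.
  have -> : \int[mu]_z ((fun z => g (x, z)) \_ [set z | 0 < tau * (z - 0)]) z =
      tau * (K (tau * N) - K 0); last first.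
    rewrite /K add0r -N'E [in X in tau * (P _ + X - _)]w0 ?mulr0; first by ring.
    by apply: section_out; rewrite normrM tn mul1r gtr0_norm// /N' /N; lra.
  apply: (@Rintegral_ray _ K _ _ (`|M| + `|phi x|)) => //.
  - exact: continuous_section.
  - move=> z zM; rewrite /g /sh/= /dx /dy !D0 ?mulr0 ?addr0//; apply: section_out;
    have := lerB_normD z (phi x); lra.
  - by rewrite /N; lra.
  - by rewrite normr0 /N; lra.
  - move=> z; rewrite ler_norml => /andP[z1 z2].
    have [px1 px2] : - `|phi x| <= phi x /\ phi x <= `|phi x|.
      by apply/andP; rewrite -ler_norml.
    have dz : is_derive z 1 (fun z => z + phi x) 1.
      by apply: is_derive_eq; rewrite addr0.
    have d1 : is_derive z 1 (P \o (fun z => z + phi x)) (dx w (x, z + phi x) * 1).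
      by apply: is_derive1_comp; apply: dP; rewrite /N in z1 z2 *; lra.
    have d2 : is_derive z 1 ((fun y => w (x, y)) \o (fun z => z + phi x))
        (dy w (x, z + phi x) * 1).
      by apply: is_derive1_comp; exact: is_derive_vertical.
    have := is_deriveD d1 (is_deriveZ (phi' x) d2).
    by rewrite !mulr1.
have MN : M < `|M| + 1 by have := ler_norm M; lra.
have N0 : - (`|M| + 1) <= `|M| + 1 by have := normr_ge0 M; lra.
(* In this order the inner integral runs along a full horizontal line, on which [g] is the
   derivative of a function vanishing at both ends. *)
have Z : \int[mu]_y \int[mu]_x (g \_ H) (x, y) = 0.
  rewrite (_ : (fun y => \int[mu]_x (g \_ H) (x, y)) = cst 0); last first.
    apply/funext => z.
    have [zH|zH] := boolP (0 < tau * z); last first.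
      rewrite (_ : (fun x => (g \_ H) (x, z)) = cst 0) ?Rintegral_cst ?mul0r//.
      by apply/funext => x; rewrite patchE ifF//; apply: memNset; apply/negP.
    rewrite (_ : (fun x => (g \_ H) (x, z)) = (fun x => g (x, z))); last first.
      by apply/funext => x; rewrite patchE mem_set.
    pose N := `|M| + 1.
    rewrite (@Rintegral_vanish _ N); last first.
      move=> x Nx; rewrite /g /dx /dy !D0 ?mulr0 ?addr0// section_outl//;
      exact: lt_trans Nx.
    rewrite (@FTC2 _ _ (fun x => w (x, z + phi x))) ?N0//.
    - by rewrite !w0 ?subrr//; apply: section_outl;
        rewrite ?normrN (lt_le_trans MN)// ler_norm.
    - move=> x; apply: (@continuous_comp _ _ _ (fun x => (x, z)) g) (cg (x, z)).
      by apply: continuous_pair_at; [exact: cvg_id|exact: cvg_cst].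
    - move=> x _; have dz : is_derive x 1 (fun x => z + phi x) (phi' x).
        rewrite -[phi' x]add0r.
        exact: (is_deriveD (is_derive_cst z x 1) (dphi x)).
      have := is_derive_comp2 openT I wC (is_derive_id x 1) dz.
      by rewrite mulr1 /g /sh /= [phi' x * _]mulrC.
  by rewrite Rintegral_cst ?mul0r.
under eq_Rintegral do rewrite J.
have cwphi : continuous (fun x => w (x, phi x)).
  move=> x; apply: (@continuous_comp _ _ _ (fun x => (x, phi x)) w) (@cw _).
  by apply: continuous_pair_at; [exact: cvg_id|exact: cphi].
have cwp : continuous (fun x => tau * (phi' x * w (x, phi x))).
  by move=> x; apply: cvgMr; apply: cvgM; [exact: cphi'|exact: cwphi].
have vwp x : M < `|x| -> tau * (phi' x * w (x, phi x)) = 0.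
  by move=> Mx; rewrite w0 ?mulr0// section_outl.
(* Fubini for [g] on the half plane passes from vertical sections to horizontal ones, where [Z]
   applies; the terms at the graph remain. *)
have [ig g1 g2] := area_integral_iterated mH cg sg.
rewrite RintegralD//.
- by rewrite -g1 g2 Z add0r; exact: Rintegral_vanish.
- have mI : measurable (`[- M, M]%classic : set R) by exact: measurable_itv.
  have := continuous_integrable (- M) M cwp.
  move=> /(iffLR (@integrable_mkcond _ _ _ mu _ _ mI)).
  rewrite restrict_EFin; congr (_.-integrable _ _); congr (EFin \o _).
  apply/funext => x; rewrite patchE; case: ifPn => //.
  rewrite notin_setE /= in_itv/= -ler_norml => /negP; rewrite -ltNge => /vwp.
  by [].
Qed.

End graph.

Lemma derive_le0_right {R : realType} (f : R -> R) (x l : R) :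
  is_derive x 1 f l -> (\forall h \near 0^'+, f (h + x) <= f x) -> l <= 0.
Proof.
move=> [df <-] fx.
have dr : h^-1 *: (f (h *: 1 + x) - f x) @[h --> (0 : R)^'+] --> 'D_1 f x.
  by apply: cvg_dnbhs_at_right; exact: df.
apply: (cvgr_to_le dr); near=> h.
have h0 : 0 < h by near: h; exact: nbhs_right_gt.
rewrite pmulr_rle0 ?invr_gt0// subr_le0 [h *: 1]mulr1.
by near: h.
Unshelve. all: by end_near. Qed.

Section swap.
Context {R : realType}.
Implicit Types (p q : R * R) (b : bool).

(** A linear isometric involution depending on a flag, so that one argument covers graphs over
    either axis and both components of a vector. *)
Definition swap b p := if b then (p.2, p.1) else p.

Lemma swapK b : involutive (swap b).
Proof. by case: b => -[]. Qed.

Lemma swap_ball b p q (r : R) : ball (swap b p) r (swap b q) <-> ball p r q.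
Proof.
by case: b => //; split=> /prod_ball[? ?]; apply/prod_ball.
Qed.

Lemma swap_norm b p : `|swap b p| = `|p|.
Proof. by case: b => //; rewrite !prod_normE /= maxC. Qed.

Lemma swap_dotp b p q : dotp (swap b p) (swap b q) = dotp p q.
Proof. by case: b => //; rewrite /dotp /= addrC. Qed.

Lemma swap_enorm b p : enorm (swap b p) = enorm p.
Proof. by rewrite /enorm swap_dotp. Qed.

Lemma swapD b p q : swap b (p + q) = swap b p + swap b q.
Proof. by case: b. Qed.

Lemma swapZ b (k : R) p : swap b (k *: p) = k *: swap b p.
Proof. by case: b. Qed.

Lemma swap_continuous b : continuous (swap b).
Proof.
move=> p; case: b; last exact: cvg_id.
by apply: continuous_pair_at; [exact: cvg_snd|exact: cvg_fst].
Qed.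

End swap.

(** * Boundary charts and normals *)

Section chart.
Context {R : realType}.
Implicit Types (p q : R * R) (Omega : set (R * R)).

(* [Omega] is near [p] the side [tau] of the graph of [phi]; [b] tells whether
   the graph is over the second axis. *)
Definition chart Omega p (b : bool) (tau : R) (phi : R -> R) (r : R) :=
  [/\ 0 < r, class_C 1 setT phi, tau = 1 \/ tau = -1 &
    forall q, ball p r q ->
      (Omega q <-> 0 < tau * ((swap b q).2 - phi (swap b q).1))].

Lemma smooth_bdry_chart Omega p : smooth_bdry_at Omega p ->
  exists b tau phi r, chart Omega p b tau phi r.
Proof.
move=> [r [phi [r0 /(_ 1%N) phiC]]] [] H.
- exists false, 1, phi, r; split => //; first by left.
  by move=> q /H ->; rewrite mul1r subr_gt0.
- exists false, (-1), phi, r; split => //; first by right.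
  by move=> q /H ->; rewrite mulN1r opprB subr_gt0.
- exists true, 1, phi, r; split => //; first by left.
  by move=> q /H ->; rewrite mul1r subr_gt0.
- exists true, (-1), phi, r; split => //; first by right.
  by move=> q /H ->; rewrite mulN1r opprB subr_gt0.
Qed.

Lemma class_C1_is_derive (V : normedModType R) (f : R -> V) :
  class_C 1 setT f -> forall x : R, is_derive x 1 f ('D_1 f x).
Proof. by move=> /class_C1P[_ /(_ 1)[df _]] x; apply: DeriveDef => //; exact: df. Qed.

Lemma class_C1_continuous (V W : normedModType R) (f : V -> W) :
  class_C 1 setT f -> continuous f.
Proof. by move=> /class_C1P[cf _] x; exact: cf. Qed.

Lemma class_C1_continuousD (V W : normedModType R) (f : V -> W) (v : V) :
  class_C 1 setT f -> continuous ('D_v f).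
Proof. by move=> /class_C1P[_ /(_ v)[_ cf]] x; exact: cf. Qed.

Variables (Omega : set (R * R)) (p : R * R) (b : bool) (tau : R).
Variables (phi : R -> R) (r : R).
Hypothesis Oopen : open Omega.
Hypothesis ch : chart Omega p b tau phi r.

Let side q : R := tau * ((swap b q).2 - phi (swap b q).1).

Let side_continuous : continuous side.
Proof.
have [_ phiC _ _] := ch.
move=> q; apply: cvgMr; apply: cvgB.
  by apply: (@continuous_comp _ _ _ (swap b) snd);
    [exact: swap_continuous|exact: cvg_snd].
apply: (@continuous_comp _ _ _ (swap b) (fun q => phi q.1)).
  exact: swap_continuous.
exact: (continuous_fst_comp (class_C1_continuous phiC)).
Qed.

Lemma tau_neq0 : tau != 0.
Proof. by case: ch => _ _ [] ->; rewrite ?oppr_eq0 oner_eq0. Qed.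

Lemma tau_sqr : tau * tau = 1.
Proof. by case: ch => _ _ [] ->; rewrite ?mulrNN mulr1. Qed.

(** Where [side] is positive the point lies in the open set [Omega]; where it is negative a whole
    neighbourhood misses [Omega]. Points of the graph are outside [Omega] but are limits of points
    moved to the side [tau]. *)
Lemma chart_bdry q : ball p r q ->
  bdry Omega q <-> (swap b q).2 = phi (swap b q).1.
Proof.
case: ch => r0 phiC _ H prq; rewrite /bdry (interior_id _).1//.
have rn : nbhs q (ball p r) by apply: open_nbhs_nbhs; split => //; exact: ball_open.
split=> [[clq nq]|E].
- have : side q <= 0 by rewrite leNgt; apply/negP => /(H _ prq).
  rewrite le_eqVlt => /predU1P[/eqP|s0].
    by rewrite mulf_eq0 (negbTE tau_neq0)/= subr_eq0 => /eqP.
  have : nbhs q [set q | ball p r q /\ side q < 0].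
    by apply: filterI => //; exact: (cvgr_lt _ (@side_continuous q)).
  by move=> /clq[q' [Oq' [/H pq' /= /ltW]]]; rewrite leNgt => /negP []; exact/pq'.
split; last by move=> /(H _ prq); rewrite E subrr mulr0 ltxx.
move=> A qA.
(* Moving by [t] across the graph makes [side] equal to t, because [tau * tau = 1]. *)
pose c (t : R) := q + t *: swap b (0, tau).
have c0 : c t @[t --> 0^'+] --> q.
  apply: cvg_at_right_filter; rewrite -[X in _ --> X]addr0.
  apply: cvgD; first exact: cvg_cst.
  rewrite -[X in _ --> X](scale0r (swap b (0, tau))).
  by apply: cvgZl; exact: cvg_id.
have : \forall t \near 0^'+, Omega (c t) /\ A (c t).
  near=> t; split; last by near: t; exact: (c0 _ qA).
  have pct : ball p r (c t) by near: t; exact: (c0 _ rn).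
  apply/(H _ pct); rewrite /c swapD swapZ swapK /= E.
  rewrite [t *: 0]mulr0 addr0 addrAC subrr add0r [t *: tau]/(_ * _).
  rewrite mulrCA tau_sqr mulr1.
  by near: t; exact: nbhs_right_gt.
by move=> Oc; have [t [Ot At]] := @filter_ex _ (0 : R)^'+ _ _ Oc; exists (c t).
Unshelve. all: by end_near. Qed.

Variables (c : R -> R * R) (n : R * R -> R * R).
Hypothesis cC : class_C 1 setT c.
Hypothesis cB : forall s, bdry Omega (c s).
Hypothesis c'0 : forall s, derive1 c s != 0.
Hypothesis nc : forall s, dotp (n (c s)) (derive1 c s) = 0.
Hypothesis n1 : forall q, bdry Omega q -> enorm (n q) = 1.
Hypothesis nout : forall q, bdry Omega q ->
  \forall t \near 0^'+, ~ Omega (q + t *: n q).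

Lemma curve_coord_continuous : continuous (fun s => (swap b (c s)).1).
Proof.
move=> s; apply: (@continuous_comp _ _ _ c (fun q => (swap b q).1)).
  exact: (class_C1_continuous cC).
by apply: (@continuous_comp _ _ _ (swap b) fst);
  [exact: swap_continuous|exact: cvg_fst].
Qed.

Lemma curve_coord'_continuous : continuous (fun s => (swap b (derive1 c s)).1).
Proof.
move=> s; apply: (@continuous_comp _ _ _ (derive1 c) (fun q => (swap b q).1)).
  have -> : derive1 c = 'D_1 c by apply/funext => t; rewrite derive1E.
  exact: (class_C1_continuousD cC).
by apply: (@continuous_comp _ _ _ (swap b) fst);
  [exact: swap_continuous|exact: cvg_fst].
Qed.

Lemma curve_coord_is_derive (s : R) :
  is_derive s 1 (fun s => (swap b (c s)).1) (swap b (derive1 c s)).1 /\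
  is_derive s 1 (fun s => (swap b (c s)).2) (swap b (derive1 c s)).2.
Proof.
have [dc D] := class_C1_is_derive cC s.
have fst_snd (k : R * R -> R) : continuous k ->
    (forall (t : R) x y, k (t *: (x - y)) = t *: (k x - k y)) ->
    is_derive s 1 (k \o c) (k (derive1 c s)).
  move=> ck kl; rewrite derive1E.
  have K : h^-1 *: ((k \o c) (h *: 1 + s) - (k \o c) s) @[h --> 0^'] -->
      k ('D_1 c s).
    rewrite (_ : (fun h => _) = k \o (fun h => h^-1 *: (c (h *: 1 + s) - c s))).
      by apply: (@cvg_comp _ _ _ _ k _ _ _ dc); exact: ck.
    by apply/funext => h; rewrite /= kl.
  by apply: DeriveDef; [apply/cvg_ex; exists (k ('D_1 c s))|exact/cvg_lim].
split.
- apply: (@fst_snd (fun q => (swap b q).1)) => [|t x y]; last by case: b.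
  by move=> q; apply: (@continuous_comp _ _ _ (swap b) fst);
    [exact: swap_continuous|exact: cvg_fst].
- apply: (@fst_snd (fun q => (swap b q).2)) => [|t x y]; last by case: b.
  by move=> q; apply: (@continuous_comp _ _ _ (swap b) snd);
    [exact: swap_continuous|exact: cvg_snd].
Qed.

Section at_point.
Variable s : R.
Hypothesis prs : ball p r (c s).
Let x := (swap b (c s)).1.
Let x' := (swap b (derive1 c s)).1.
Let y' := (swap b (derive1 c s)).2.

Lemma near_curve : \forall t \near s, ball p r (c t).
Proof.
apply: (class_C1_continuous cC) => //.
by apply: open_nbhs_nbhs; split => //; exact: ball_open.
Qed.

(** Near [s] the curve runs inside the boundary, that is on the graph, and y = phi x is
    differentiated along it. *)
Lemma curve_slope : y' = 'D_1 phi x * x'.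
Proof.
have [_ phiC _ _] := ch.
have [d1 d2] := curve_coord_is_derive s.
have d3 : is_derive s 1 (phi \o (fun s => (swap b (c s)).1)) ('D_1 phi x * x').
  by apply: is_derive1_comp; exact: class_C1_is_derive.
have [_ E3] := d3; have [_ E2] := d2; rewrite /y' -E3 -E2.
apply: near_eq_derive; near=> t; apply/(chart_bdry _) => //.
by near: t; exact: near_curve.
Unshelve. all: by end_near. Qed.

Lemma curve_coord'_neq0 : x' != 0.
Proof.
apply/eqP => x0; have y0 : y' = 0 by rewrite curve_slope x0 mulr0.
have := c'0 s; rewrite -[derive1 c s](swapK b).
rewrite [swap b (derive1 c s)]surjective_pairing -/x' -/y' x0 y0.
by case: b; rewrite eqxx.
Qed.

(** Orthogonality makes the normal proportional to (phi', -1), unit length fixes the modulus, and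
    the outward condition fixes the sign. The speed is |x'| times the square root of 1 + phi'^2,
    which cancels the normalisation of the normal. *)
Lemma normal_formula :
  (swap b (n (c s))).1 * enorm (derive1 c s) = tau * ('D_1 phi x * `|x'|) /\
  (swap b (n (c s))).2 * enorm (derive1 c s) = - tau * `|x'|.
Proof.
case: ch => r0 phiC tau1 H.
set d : R := 'D_1 phi x.
set a1 := (swap b (n (c s))).1; set a2 := (swap b (n (c s))).2.
have x'0 := curve_coord'_neq0; have sl := curve_slope.
have a12 : a1 = - (d * a2).
  have := nc s; rewrite -(swap_dotp b) /dotp -/a1 -/a2 -/x' -/y' sl -/d => E.
  apply: (mulIf x'0); move: E; rewrite mulNr => E; apply/eqP.
  by rewrite -subr_eq0 opprK -E; apply/eqP; ring.
have a2sq : a2 * a2 * (1 + d * d) = 1.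
  have E : dotp (swap b (n (c s))) (swap b (n (c s))) = 1.
    rewrite swap_dotp -[LHS]sqr_sqrtr; last by rewrite addr_ge0// -expr2 sqr_ge0.
    by rewrite -[Num.sqrt _]/(enorm _) n1// expr1n.
  by rewrite -[RHS]E /dotp -/a1 -/a2 a12; ring.
have ta2 : tau * a2 <= 0.
  have dline (k x0 : R) : is_derive (0 : R) 1 (fun t : R => x0 + t * k) k.
    have := is_deriveD (is_derive_cst x0 (0 : R) 1)
      (is_deriveM (is_derive_id (0 : R) 1) (is_derive_cst k (0 : R) 1)).
    by rewrite add0r scaler0 add0r [_ *: _]mulr1.
  have dphi : is_derive (0 : R) 1 (phi \o (fun t => x + t * a1)) (d * a1).
    apply: is_derive1_comp; rewrite mul0r addr0.
    exact: class_C1_is_derive.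
  (* Along the normal [side] starts at 0 and is not positive for small t > 0, as these points are
     outside [Omega]; its derivative at 0 is therefore at most 0. *)
  pose psi (t : R) : R := side (c s + t *: n (c s)).
  have dpsi : is_derive (0 : R) 1 psi (tau * (a2 - d * a1)).
    have := is_deriveZ tau (is_deriveB (dline a2 (swap b (c s)).2) dphi).
    congr (is_derive _ _ _ _).
    by apply/funext => t; rewrite /psi /side swapD swapZ.
  have psi0 : psi 0 = 0.
    rewrite /psi scale0r addr0 /side.
    by rewrite ((chart_bdry prs).1 (cB s)) subrr mulr0.
  have : tau * (a2 - d * a1) <= 0.
    apply: (derive_le0_right dpsi); rewrite psi0.
    have cc : c s + t *: n (c s) @[t --> 0^'+] --> c s.
      apply: cvg_at_right_filter; rewrite -[X in _ --> X]addr0.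
      apply: cvgD; first exact: cvg_cst.
      rewrite -[X in _ --> X](scale0r (n (c s))).
      by apply: cvgZl; exact: cvg_id.
    near=> t; rewrite addr0 leNgt; apply/negP.
    have pct : ball p r (c s + t *: n (c s)).
      near: t; apply: (cc (ball p r)).
      by apply: open_nbhs_nbhs; split => //; exact: ball_open.
    move=> /(H _ pct).
    by near: t; exact: nout.
  have -> : tau * (a2 - d * a1) = (tau * a2) * (1 + d * d) by rewrite a12; ring.
  by rewrite pmulr_lle0// ltr_pwDl// -expr2 sqr_ge0.
set E := enorm (derive1 c s).
have E0 : 0 <= E by rewrite sqrtr_ge0.
have Esq : E * E = x' * x' * (1 + d * d).
  rewrite /E -(swap_enorm b) -expr2 sqr_sqrtr; last first.
    by rewrite addr_ge0// -expr2 sqr_ge0.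
  by rewrite /dotp -/x' -/y' sl -/d; ring.
have aE : a2 * E = - tau * `|x'|.
  (* The unit length and the speed are known through their squares only; the sign of [tau * a2]
     selects the root. *)
  have S : (tau * (a2 * E)) ^+ 2 = `|x'| ^+ 2.
    rewrite real_normK ?num_real//.
    transitivity ((tau * tau) * ((a2 * a2) * (E * E))); first by ring.
    rewrite tau_sqr Esq.
    transitivity ((a2 * a2 * (1 + d * d)) * (x' * x')); first by ring.
    by rewrite a2sq mul1r expr2.
  have N : tau * (a2 * E) = - `|x'|.
    have le0 : tau * (a2 * E) <= 0 by rewrite mulrA mulr_le0_ge0.
    have : `|tau * (a2 * E)| = `|x'|.
      apply/eqP; rewrite -(@eqrXn2 _ 2)// real_normK ?num_real// S.
      by rewrite real_normK ?num_real.
    by rewrite ler0_norm// => <-; rewrite opprK.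
  transitivity (tau * (tau * (a2 * E))); first by rewrite [RHS]mulrA tau_sqr mul1r.
  by rewrite N; ring.
split => //.
by rewrite a12 mulNr -mulrA aE; ring.
Unshelve. all: by end_near. Qed.

End at_point.

End chart.

Lemma Rintegral_subset d (T : measurableType d) (R : realType)
    (mu : {measure set T -> \bar R}) (A B : set T) (f : T -> R) :
  A `<=` B -> (forall x, B x -> ~ A x -> f x = 0) ->
  \int[mu]_(x in B) f x = \int[mu]_(x in A) f x.
Proof.
move=> AB f0; rewrite [LHS]Rintegral_mkcond [RHS]Rintegral_mkcond.
apply: eq_Rintegral => x _; rewrite !patchE.
have [xA|xA] := boolP (x \in A); first by rewrite mem_set//; apply: AB; rewrite inE in xA.
case: ifPn => //; rewrite inE => Bx; rewrite f0//.
by rewrite notin_setE in xA.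
Qed.

(** With a primitive [P], the function P (x + 1) - P x has derivative f (x + 1) - f x = 0. This
    recentres the parameter interval of a closed curve at any chosen point. *)
Lemma Rintegral_periodic (R : realType) (f : R -> R) (a : R) : continuous f ->
  (forall s, f (s + 1) = f s) ->
  \int[lebesgue_measure]_(s in `[0, 1]) f s =
  \int[lebesgue_measure]_(s in `[a, a + 1]) f s.
Proof.
move=> cf fper; pose c := - (`|a| + 1).
have aa : - `|a| <= a by have /andP[] : - `|a| <= a <= `|a| by rewrite -ler_norml.
have a0 := normr_ge0 a.
have [P dP] := primitive c cf.
have ca : c < a by rewrite /c; lra.
have c0 : c < 0 by rewrite /c; lra.
have F x : c < x -> \int[lebesgue_measure]_(s in `[x, x + 1]) f s = P (x + 1) - P x.
  move=> cx; apply: FTC2 => //; first by rewrite lerDl.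
  by move=> y; rewrite in_itv/= => /andP[xy _]; apply: dP; exact: lt_le_trans xy.
rewrite -[X in `[0, X]]add0r !F//.
pose G x := P (x + 1) - P x.
have dG (y : R) : `|y - 0| <= `|a| -> is_derive y 1 G ((fun=> 0) y).
  rewrite subr0 ler_norml => /andP[ay _].
  have cy : c < y by rewrite /c; lra.
  have d1 : is_derive y 1 (fun z : R => z + 1) 1.
    have := is_deriveD (is_derive_id y 1) (is_derive_cst (1 : R) y 1).
    by rewrite addr0.
  have d2 : is_derive y 1 (P \o (fun z => z + 1)) (f (y + 1) * 1).
    by apply: is_derive1_comp; apply: dP; lra.
  have := is_deriveB d2 (dP y cy).
  by rewrite mulr1 fper subrr.
have [_ _ E] := MVT_dist dG.
by move/eqP: E; rewrite /= mul0r add0r subr_eq0 eq_sym => /eqP.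
Qed.

(** * Closed boundary curves modulo their period *)

Section closed_curves.
Context {R : realType} (Omega : set (R * R)) (m : nat) (gamma : 'I_m -> R -> R * R).
Hypothesis bp : bdry_param Omega gamma.

Lemma bdry_param_period i (s : R) (k : int) : gamma i (s + k%:~R) = gamma i s.
Proof.
have [_ per _ _ _] := bp.
have P (j : nat) t : gamma i (t + j%:R) = gamma i t.
  elim: j t => [|j IH] t; first by rewrite addr0.
  by rewrite -natr1 addrA per IH.
case: k => j; first exact: P.
by rewrite NegzE mulrNz -[LHS](P j.+1) subrK.
Qed.

Lemma bdry_param_inj i j (s t : R) : gamma i s = gamma j t ->
  i = j /\ exists k : int, s = t + k%:~R.
Proof.
have [_ _ _ inj _] := bp => E.
have frac (x : R) : 0 <= x - (Num.floor x)%:~R < 1.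
  by rewrite subr_ge0 ltrBlDl ge_floor -intrD1 floorD1_gt.
have sE i' x : gamma i' x = gamma i' (x - (Num.floor x)%:~R).
  by rewrite -mulrNz bdry_param_period.
have [-> ] := inj _ _ _ _ (frac s) (frac t) (etrans (esym (sE i s)) (etrans E (sE j t))).
move=> st; split => //; exists (Num.floor s - Num.floor t).
by rewrite rmorphB/=; lra.
Qed.

Lemma bdry_param_near_inj i0 i (s0 s : R) : `|s - s0| <= 2^-1 ->
  gamma i s = gamma i0 s0 -> i = i0 /\ s = s0.
Proof.
move=> ss0 /bdry_param_inj[-> [k sk]]; split=> //.
suff -> : s = s0 + 0%:~R by rewrite addr0.
rewrite sk; congr (s0 + _%:~R); apply/eqP; rewrite -normr_le0 -ltzD1 add0r -(ltr_int R).
rewrite intr_norm; rewrite sk addrAC subrr add0r in ss0.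
by rewrite (le_lt_trans ss0)// invf_lt1// ltr1n.
Qed.

(** A parameter of the window either gives the centre itself, and is then [s0] on curve [i0] by
    injectivity, or gives a point at positive distance from it. Compactness of the window makes the
    radius uniform, and there are finitely many curves. *)
Lemma bdry_param_isolated i0 (s0 d : R) : 0 < d ->
  \forall rho \near 0^'+, forall i s, `|s - s0| <= 2^-1 ->
    ball (gamma i0 s0) rho (gamma i s) -> i = i0 /\ `|s - s0| < d.
Proof.
move=> d0; have [sm _ _ _ _] := bp.
pose P i rho s := ball (gamma i0 s0) rho (gamma i s) -> i = i0 /\ `|s - s0| < d.
have : \forall rho \near 0^'+, forall i,
    (`[s0 - 2^-1, s0 + 2^-1]%classic : set R) `<=` P i rho.
  apply: filter_forall => i.
  have /compact_near_coveringP ncov := @segment_compact R (s0 - 2^-1) (s0 + 2^-1).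
  apply: (ncov _ (0 : R)^'+ (P i)) => x; rewrite /= in_itv/= => xI.
  have xs0 : `|x - s0| <= 2^-1 by rewrite ler_norml; lra.
  have [E|NE] := pselect (gamma i x = gamma i0 s0).
    have [-> ->] := bdry_param_near_inj xs0 E.
    exists (ball s0 d, setT); first by split; [exact: nbhsx_ballx|exact: filterT].
    by move=> [x' rho] [/= Bx' _] _; split => //; rewrite distrC.
  (* Half the distance: points within [e] of [gamma i x] are then not within any [rho < e] of the
     centre. *)
  pose e := `|gamma i x - gamma i0 s0| / 2.
  have e0 : 0 < e by rewrite divr_gt0// normr_gt0 subr_eq0; apply/eqP.
  have cg : continuous (gamma i) by exact: (class_C1_continuous (sm i 1%N)).
  exists (gamma i @^-1` ball (gamma i x) e, [set rho | rho < e]).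
    split; last exact: nbhs_right_lt.
    by apply: cg; exact: nbhsx_ballx.
  move=> [x' rho]; rewrite /P -!ball_normE /= => -[B' rhoe] B; exfalso.
  have := ler_distD (gamma i x') (gamma i x) (gamma i0 s0).
  rewrite [X in X <= _](_ : _ = e + e); last by rewrite /e -splitr.
  by rewrite leNgt ltrD// distrC (lt_trans B).
apply: filterS => rho H i s ss0; apply: H.
by rewrite /= in_itv/=; move: ss0; rewrite ler_norml; lra.
Unshelve. all: by end_near. Qed.

End closed_curves.

Lemma lt_minB1 (R : realDomainType) (a b x : R) :
  (a <= x) || (b <= x) -> Num.min a b - 1 < x.
Proof.
rewrite ltrBlDr gt_min => /orP[ax|bx]; apply/orP.
- by left; rewrite (le_lt_trans ax)// ltrDl.
- by right; rewrite (le_lt_trans bx)// ltrDl.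
Qed.

(** Brings a parameter into the window of [bdry_param_isolated] without changing the point of the
    curve. *)
Lemma shift_near (R : realType) (s s0 : R) :
  `|s + (- Num.floor (s - s0 + 2^-1))%:~R - s0| <= 2^-1.
Proof.
have := ge_floor (s - s0 + 2^-1); have := floorD1_gt (s - s0 + 2^-1).
by rewrite intrD1 rmorphN/= ler_norml; lra.
Qed.

(** * Arc length integrals in a boundary chart *)

Section local_divergence.
Context {R : realType} (Omega : set (R * R)) (m : nat) (gamma : 'I_m -> R -> R * R).
Variable n : R * R -> R * R.
Notation mu := (@lebesgue_measure R).
Hypothesis Oopen : open Omega.
Hypothesis bp : bdry_param Omega gamma.
Hypothesis nu : outward_unit_normal Omega gamma n.
Hypothesis Obdry : forall p, bdry Omega p -> smooth_bdry_at Omega p.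

Let gC i : class_C 1 setT (gamma i).
Proof. by have [sm _ _ _ _] := bp; exact: sm. Qed.

Lemma bdry_param_bdry i s : bdry Omega (gamma i s).
Proof. by have [_ _ _ _ im] := bp; apply/im; exists i, s. Qed.

Lemma curve_normal_formula p b tau phi r i s : chart Omega p b tau phi r ->
  ball p r (gamma i s) ->
  (swap b (n (gamma i s))).1 * enorm (derive1 (gamma i) s) =
    tau * ('D_1 phi (swap b (gamma i s)).1 * `|(swap b (derive1 (gamma i) s)).1|) /\
  (swap b (n (gamma i s))).2 * enorm (derive1 (gamma i) s) =
    - tau * `|(swap b (derive1 (gamma i) s)).1|.
Proof.
move=> ch; have [_ _ g'0 _ _] := bp; have [nt nn] := nu.
apply: (normal_formula Oopen ch (gC i) (bdry_param_bdry i) (g'0 i) (nt i)).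
- by move=> q /nn[].
- by move=> q /nn[].
Qed.

(** Continuity comes from the chart formula, not from [n]. According to whether the chart is over
    the axis [b], the component is [tau] times phi' |x'| or [- tau] times |x'|. *)
Lemma curve_normal_continuous b i :
  continuous (fun s => (swap b (n (gamma i s))).1 * enorm (derive1 (gamma i) s)).
Proof.
move=> s; have [b' [tau [phi [r ch]]]] := smooth_bdry_chart (Obdry (bdry_param_bdry i s)).
have [r0 phiC _ _] := ch.
have cx : {for s, continuous (fun t => (swap b' (gamma i t)).1)}.
  exact: curve_coord_continuous (gC i) s.
have cx' : {for s, continuous (fun t => `|(swap b' (derive1 (gamma i) t)).1|)}.
  by apply: cvg_norm; exact: curve_coord'_continuous (gC i) s.
have N : \forall t \near s, ball (gamma i s) r (gamma i t).
  exact: (near_curve (gC i) (ballxx _ r0)).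
have [b'b|b'b] := eqVneq b' b.
- have E : \forall t \near s,
     tau * ('D_1 phi (swap b (gamma i t)).1 * `|(swap b (derive1 (gamma i) t)).1|) =
     (swap b (n (gamma i t))).1 * enorm (derive1 (gamma i) t).
    rewrite -b'b; near=> t; have pt : ball (gamma i s) r (gamma i t) by near: t.
    by have [-> _] := curve_normal_formula ch pt.
  apply: (cvg_trans (near_eq_cvg E)); rewrite -(nbhs_singleton E) -b'b.
  apply: cvgMr; apply: cvgM cx'.
  apply: (@continuous_comp _ _ _ (fun t => (swap b' (gamma i t)).1) ('D_1 phi)) => //.
  exact: class_C1_continuousD.
- have S q : (swap b q).1 = (swap b' q).2 by case: (b) (b') b'b => -[].
  have E : \forall t \near s, - tau * `|(swap b' (derive1 (gamma i) t)).1| =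
     (swap b (n (gamma i t))).1 * enorm (derive1 (gamma i) t).
    near=> t; have pt : ball (gamma i s) r (gamma i t) by near: t.
    by rewrite S; have [_ ->] := curve_normal_formula ch pt.
  apply: (cvg_trans (near_eq_cvg E)); rewrite -(nbhs_singleton E).
  exact: cvgMr.
Unshelve. all: by end_near. Qed.

Section chart_integrals.
Variables (p : R * R) (b : bool) (tau : R) (phi : R -> R) (r : R).
Hypothesis ch : chart Omega p b tau phi r.

Let phiC : class_C 1 setT phi.
Proof. by case: ch. Qed.

Let graph (x : R) := swap b (x, phi x).

Let graph_continuous : continuous graph.
Proof.
move=> x; apply: (@continuous_comp _ _ _ (fun x => (x, phi x)) (swap b)).
  by apply: continuous_pair_at; [exact: cvg_id|exact: (class_C1_continuous phiC)].
exact: swap_continuous.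
Qed.

(** The substitution x = [X s] on the only arc that meets the support. [nuf] stands for either
    component of the normal, with [kappa] equal to tau phi' or to - tau. *)
Lemma oint_chart (i0 : 'I_m) (s0 : R) (nuf : R * R -> R) (kappa : R -> R) :
  gamma i0 s0 = p -> continuous kappa ->
  (forall i, continuous (fun s => nuf (gamma i s) * enorm (derive1 (gamma i) s))) ->
  (forall s, ball p r (gamma i0 s) -> nuf (gamma i0 s) * enorm (derive1 (gamma i0) s) =
     kappa (swap b (gamma i0 s)).1 * `|(swap b (derive1 (gamma i0) s)).1|) ->
  \forall rho \near 0^'+, forall w : R * R -> R, continuous w ->
    (forall q, ~ ball p rho q -> w q = 0) ->
    oint gamma (fun q => w q * nuf q) = \int[mu]_x (kappa x * w (graph x)).
Proof.
move=> ps ckappa cnu nuE; have [r0 _ _ _] := ch.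
have [_ per g'0 _ im] := bp.
pose X s := (swap b (gamma i0 s)).1.
pose X' s := (swap b (derive1 (gamma i0) s)).1.
have cX : continuous X by exact: curve_coord_continuous (gC i0).
have cX' : continuous X' by exact: curve_coord'_continuous (gC i0).
have ps0 : ball p r (gamma i0 s0) by rewrite ps; exact: ballxx.
have X'0 : X' s0 != 0.
  exact: (curve_coord'_neq0 Oopen ch (gC i0) (bdry_param_bdry i0) (g'0 i0) ps0).
(* [e] is the sign of [X'] at [s0], since the curve may be traversed in either direction. *)
have [e [e1 eX]] : exists e, (e = 1 \/ e = -1) /\ 0 < e * X' s0.
  have [X0|X0] := ltP 0 (X' s0); first by exists 1; split; [left|rewrite mul1r].
  exists (-1); split; first by right.
  by rewrite mulN1r oppr_gt0 lt_neqAle X'0.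
have ee : e * e = 1 by case: e1 => ->; rewrite ?mulrNN mulr1.
have : \forall s \near s0, ball p r (gamma i0 s) /\ 0 < e * X' s.
  apply: filterI; first exact: (near_curve (gC i0) ps0).
  have ceX : e * X' s @[s --> s0] --> e * X' s0 by apply: cvgMr; exact: cX'.
  exact: (cvgr_gt _ ceX _ eX).
move=> /nbhs_ballP[d0 /= d00 d0P].
(* Half of [d0] keeps the closed arc inside the open neighbourhood; the bound 1/2 keeps it inside
   the window of one period. *)
pose d := Num.min (d0 / 2) 2^-1.
have d_gt0 : 0 < d by rewrite lt_min divr_gt0//= invr_gt0.
have d_half : d <= 2^-1 by rewrite ge_min lexx orbT.
have dP s : `|s - s0| <= d -> ball p r (gamma i0 s) /\ 0 < e * X' s.
  move=> sd; apply: d0P; rewrite /ball/= distrC (le_lt_trans sd)//.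
  by rewrite gt_min ltr_pdivrMr// ltr_pMr// ltr1n.
have iso0 := bdry_param_isolated bp i0 s0 d_gt0; rewrite ps in iso0.
near=> rho => w cw w0.
have rhor : rho <= r by near: rho; exact: nbhs_right_le.
have iso : forall i s, `|s - s0| <= 2^-1 ->
    ball p rho (gamma i s) -> i = i0 /\ `|s - s0| < d.
  by near: rho; exact: iso0.
pose F i s := w (gamma i s) * nuf (gamma i s) * enorm (derive1 (gamma i) s).
have cF i : continuous (F i).
  move=> s; rewrite /F; under eq_fun do rewrite -mulrA.
  apply: cvgM; last exact: cnu.
  apply: (@continuous_comp _ _ _ (gamma i) w); last exact: cw.
  exact: (class_C1_continuous (gC i)).
have perF i s : F i (s + 1) = F i s.
  suff D : derive1 (gamma i) (s + 1) = derive1 (gamma i) s by rewrite /F per D.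
  rewrite /derive1 (_ : (fun h => h^-1 *: (gamma i (h + (s + 1)) - _)) =
    fun h => h^-1 *: (gamma i (h + s) - gamma i s))//.
  by apply/funext => h; rewrite addrA !per.
have half : s0 + 2^-1 = s0 - 2^-1 + 1 :> R by lra.
rewrite /oint (bigD1 i0)//= [X in _ + X]big1 ?addr0; last first.
  move=> i ii0; rewrite (@Rintegral_periodic R (F i) (s0 - 2^-1) (cF i) (perF i)) -half.
  rewrite (@eq_Rintegral _ _ _ _ _ (cst 0)) ?Rintegral_cst ?mul0r// => s.
  rewrite inE/= in_itv/= => sI; rewrite /F w0 ?mul0r// => /iso[].
    by rewrite ler_distl.
  by move=> /eqP; rewrite (negbTE ii0).
rewrite (@Rintegral_periodic R (F i0) (s0 - 2^-1) (cF i0) (perF i0)) -half.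
have -> : \int[mu]_(s in `[s0 - 2^-1, s0 + 2^-1]) F i0 s =
    \int[mu]_(s in `[s0 - d, s0 + d]) F i0 s.
  apply: Rintegral_subset => s /=; rewrite !in_itv/= -!ler_distl.
    by move=> sd; exact: le_trans d_half.
  by move=> sI sd; rewrite /F w0 ?mul0r// => /iso[] // _ /ltW.
pose k x := kappa x * w (graph x).
have ck : continuous k.
  move=> x; apply: cvgM; first exact: ckappa.
  by apply: (@continuous_comp _ _ _ graph w); [exact: graph_continuous|exact: cw].
pose X1 := X (s0 - d); pose X2 := X (s0 + d).
have [P dP1] := primitive (Num.min X1 X2 - 1) ck.
have dX (s : R) : is_derive s 1 X (X' s) by have [] := curve_coord_is_derive b (gC i0) s.
have mono s t : s0 - d <= s -> s <= t -> t <= s0 + d -> e * X s <= e * X t.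
  move=> ds st td; rewrite -subr_ge0 -mulrBr.
  have [c] := MVT_segment st (fun y _ => dX y) (continuous_subspaceT cX).
  rewrite in_itv/= => /andP[sc ct] ->.
  have cd : `|c - s0| <= d.
    by rewrite ler_distl (le_trans ds)//= (le_trans ct).
  have [_ X'c] := dP c cd.
  by rewrite mulrA; apply: mulr_ge0; [exact: ltW|rewrite subr_ge0].
have monoX s : `|s - s0| <= d -> e * X1 <= e * X s /\ e * X s <= e * X2.
  by rewrite ler_distl => /andP[? ?]; split; apply: mono.
(* A graph point in the support is a boundary point, hence lies on some curve; shifted into the
   window, its parameter belongs to the arc, so [x] lies between the end values [X1] and [X2]. *)
have k0 x : ~ (e * X1 <= e * x /\ e * x <= e * X2) -> k x = 0.
  move=> xX; rewrite /k w0 ?mulr0// => gr.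
  have gr' : ball p r (graph x) by exact: le_ball rhor _ gr.
  have : bdry Omega (graph x).
    by apply/(chart_bdry Oopen ch gr'); rewrite /graph swapK.
  move=> /im[i [s gs]].
  pose s' := s + (- Num.floor (s - s0 + 2^-1))%:~R.
  have gs' : gamma i s' = graph x by rewrite /s' (bdry_param_period bp).
  have ss' : `|s' - s0| <= 2^-1.
    exact: shift_near.
  have := iso i s' ss'; rewrite gs' => /(_ gr)[ii0 sd].
  apply: xX; rewrite (_ : x = X s'); first by apply: monoX; exact: ltW.
  by rewrite /X -ii0 gs' /graph swapK.
have kE A B : A <= B -> Num.min X1 X2 - 1 < A -> (forall x, ~ (A <= x <= B) -> k x = 0) ->
    \int[mu]_x k x = P B - P A.
  move=> AB cA kAB.
  have -> : \int[mu]_x k x = \int[mu]_(x in `[A, B]) k x.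
    by apply: Rintegral_subset => // x _ /=; rewrite in_itv/=; exact: kAB.
  apply: FTC2 => // x; rewrite in_itv/= => /andP[Ax _].
  by apply: dP1; exact: lt_le_trans Ax.
(* The substitution is done by the fundamental theorem: [e * P (X s)] has derivative
   [e * k (X s) * X' s], and [e * X' s] is [|X' s|]. *)
have EF : \int[mu]_(s in `[s0 - d, s0 + d]) F i0 s = e * P X2 - e * P X1.
  apply: (@FTC2 _ (F i0) (fun s => e * P (X s))); [lra|exact: cF|].
  move=> s; rewrite in_itv/= => sI.
  have sd : `|s - s0| <= d by rewrite ler_distl.
  have [pr eX's] := dP s sd.
  have cXs : Num.min X1 X2 - 1 < X s.
    have [m1 m2] := monoX s sd.
    apply: lt_minB1.
    by case: e1 m1 m2 => ->; rewrite ?mul1r ?mulN1r ?lerN2 => m1 m2;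
      rewrite ?m1 ?m2 ?orbT.
  have d1 := is_derive1_comp (dP1 _ cXs) (dX s).
  have := is_deriveZ e d1; congr (is_derive _ _ _ _).
  rewrite /F -mulrA nuE// /k.
  have -> : graph (X s) = gamma i0 s.
    rewrite /graph /X -((chart_bdry Oopen ch pr).1 (bdry_param_bdry i0 s)).
    by rewrite -surjective_pairing swapK.
  have -> : `|X' s| = e * X' s.
    case: e1 eX's => ->; rewrite ?mul1r ?mulN1r => x0; first by rewrite gtr0_norm.
    by rewrite ltr0_norm// -oppr_gt0.
  change (e * (kappa (X s) * w (gamma i0 s) * X' s) =
    w (gamma i0 s) * (kappa (X s) * (e * X' s))).
  by ring.
rewrite {}EF; have s0d : `|s0 - s0| <= d by rewrite subrr normr0 ltW.
have [m1 m2] := monoX s0 s0d.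
case: e1 m1 m2 k0 => ->; rewrite ?mul1r ?mulN1r ?lerN2 => m1 m2 k0.
- have X12 : X1 <= X2 by exact: le_trans m2.
  rewrite (kE X1 X2)//; first by apply: lt_minB1; rewrite lexx.
  by move=> x xX; apply: k0; rewrite !mul1r => -[? ?]; apply: xX; apply/andP.
- have X12 : X2 <= X1 by exact: le_trans m1.
  rewrite (kE X2 X1)//; [by rewrite opprK addrC|by apply: lt_minB1; rewrite lexx orbT|].
  by move=> x xX; apply: k0; rewrite ?mulN1r ?lerN2 => -[? ?]; apply: xX; apply/andP.
Unshelve. all: by end_near. Qed.

End chart_integrals.

End local_divergence.

Section derive_line.
Context {R : realType} {V V' W : normedModType R}.
Variables (f : V -> W) (g : V' -> W) (a v : V) (a' v' : V').
Hypothesis fg : forall h : R, f (h *: v + a) = g (h *: v' + a').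

Let quotient : (fun h : R => h^-1 *: ((f \o shift a) (h *: v) - f a)) =
  (fun h : R => h^-1 *: ((g \o shift a') (h *: v') - g a')).
Proof.
apply/funext => h /=; rewrite fg; congr (_ *: (_ - _)).
by have := fg 0; rewrite !scale0r !add0r.
Qed.

(** A directional derivative depends on the function along one line only, so it can be read off
    another function, even on another space. This relates derivatives on space-time to those in
    time, in space, and after [swap]. *)
Lemma derive_line : 'D_v f a = 'D_v' g a'.
Proof. by rewrite /derive quotient. Qed.

Lemma is_derive_line d : is_derive a v f d -> is_derive a' v' g d.
Proof.
by move=> [df <-]; apply: DeriveDef; rewrite ?derive_line// /derivable -quotient.
Qed.

End derive_line.

(** * Functions of class C^1 and cutoffs *)

Section class_C1_algebra.
Context {R : realType} {V : normedModType R}.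
Implicit Types (U : set V) (f g : V -> R).

(** [Df] agrees with the derivative on [U], hence near each point of the open set [U], so its
    continuity there carries over. *)
Lemma class_C1_intro U f (Df : V -> V -> R) : open U ->
  (forall x, U x -> {for x, continuous f}) ->
  (forall v x, U x -> is_derive x v f (Df v x)) ->
  (forall v x, U x -> {for x, continuous (Df v)}) -> class_C 1 U f.
Proof.
move=> oU cf df cDf; apply/class_C1P; split=> // v; split=> x Ux.
  by have [] := df v x Ux.
have E : \forall y \near x, Df v y = 'D_v f y.
  have := open_nbhs_nbhs (conj oU Ux); apply: filterS => y /(df v)[_ ->].
  by [].
apply: (cvg_trans (near_eq_cvg E)); rewrite -(nbhs_singleton E).
exact: cDf.
Qed.

Lemma class_C1_derive U f v x : class_C 1 U f -> U x ->
  is_derive x v f ('D_v f x).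
Proof. by move=> /class_C1P[_ /(_ v)[df _]] Ux; apply: DeriveDef => //; exact: df. Qed.

Lemma class_C1_cont U f x : class_C 1 U f -> U x -> {for x, continuous f}.
Proof. by move=> /class_C1P[cf _]; exact: cf. Qed.

Lemma class_C1_contD U f v x : class_C 1 U f -> U x -> {for x, continuous ('D_v f)}.
Proof. by move=> /class_C1P[_ /(_ v)[_ cf]]; exact: cf. Qed.

Lemma class_C1_subset U U' f : U `<=` U' -> class_C 1 U' f -> class_C 1 U f.
Proof.
move=> UU' /class_C1P[cf df]; apply/class_C1P; split=> [x /UU'|v]; first exact: cf.
by have [d1 d2] := df v; split=> x /UU'; [exact: d1|exact: d2].
Qed.

Lemma class_C1_cst U (k : R) : open U -> class_C 1 U (cst k).
Proof.
move=> oU; apply: (@class_C1_intro _ _ (fun _ => cst 0)) => // [x _|v x _].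
- exact: cst_continuous.
- exact: cst_continuous.
Qed.

Lemma class_C1D U f g : open U -> class_C 1 U f -> class_C 1 U g ->
  class_C 1 U (fun x => f x + g x).
Proof.
move=> oU fC gC.
apply: (@class_C1_intro _ _ (fun v x => 'D_v f x + 'D_v g x)) => // [x Ux|v x Ux|v x Ux].
- by apply: cvgD; [exact: class_C1_cont fC Ux|exact: class_C1_cont gC Ux].
- by apply: is_deriveD; exact: class_C1_derive Ux.
- by apply: cvgD; [exact: class_C1_contD fC Ux|exact: class_C1_contD gC Ux].
Qed.

Lemma class_C1M U f g : open U -> class_C 1 U f -> class_C 1 U g ->
  class_C 1 U (fun x => f x * g x).
Proof.
move=> oU fC gC.
have cf := class_C1_cont fC; have cg := class_C1_cont gC.
apply: (@class_C1_intro _ _ (fun v x => f x * 'D_v g x + g x * 'D_v f x)) =>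
  // [x Ux|v x Ux|v x Ux].
- by apply: cvgM; [exact: cf|exact: cg].
- by apply: is_deriveM; exact: class_C1_derive Ux.
- apply: cvgD; apply: cvgM; [exact: cf|exact: class_C1_contD gC Ux|exact: cg|].
  exact: class_C1_contD fC Ux.
Qed.

Lemma class_C1_eq U f g : open U -> (forall x, U x -> f x = g x) ->
  class_C 1 U f -> class_C 1 U g.
Proof.
move=> oU fg fC.
have E x : U x -> \forall y \near x, f y = g y.
  by move=> Ux; have := open_nbhs_nbhs (conj oU Ux); apply: filterS => y /fg.
apply: (@class_C1_intro _ _ (fun v => 'D_v f)) => // [x Ux|v x Ux|v x Ux].
- apply: (cvg_trans (near_eq_cvg (E x Ux))); rewrite -fg//.
  exact: class_C1_cont fC Ux.
- by apply: near_eq_is_derive (E x Ux) (class_C1_derive v fC Ux).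
- exact: class_C1_contD fC Ux.
Qed.

Lemma class_C1_setU U U' f : class_C 1 U f -> class_C 1 U' f ->
  class_C 1 (U `|` U') f.
Proof.
move=> /class_C1P[c1 d1] /class_C1P[c2 d2]; apply/class_C1P; split.
  by move=> x [/c1|/c2].
move=> v; have [a1 b1] := d1 v; have [a2 b2] := d2 v.
by split=> x [Ux|Ux]; [exact: a1|exact: a2|exact: b1|exact: b2].
Qed.

Lemma class_C1_affine (s s' : R -> R) (l L : V -> R) :
  (forall x : R, is_derive x 1 s (s' x)) -> continuous s' ->
  (forall x v (h : R), L (h *: v + x) = h * l v + L x) -> continuous L ->
  class_C 1 setT (s \o L).
Proof.
move=> ds cs' Ll cL.
apply: (@class_C1_intro _ _ (fun v x => s' (L x) * l v)) => [|x _|v x _|v x _].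
- exact: openT.
- apply: continuous_comp; first exact: cL.
  exact: is_derive_continuous (ds _).
- have dh : is_derive (0 : R) 1 (fun h : R => h * l v + L x) (l v).
    have := is_deriveD (is_deriveM (is_derive_id (0 : R) 1) (is_derive_cst (l v) (0 : R) 1))
      (is_derive_cst (L x) (0 : R) 1).
    by rewrite addr0 scaler0 add0r [_ *: _]mulr1.
  have dsh : is_derive (0 : R) 1 (fun h => (s \o L) (h *: v + x)) (s' (L x) * l v).
    rewrite (_ : (fun h => _) = s \o (fun h => h * l v + L x)).
      apply: is_derive1_comp.
      by rewrite mul0r add0r; exact: ds.
    by apply/funext => h /=; rewrite Ll.
  apply: is_derive_line dsh => h; congr (s (L _)).
  by rewrite [h *: 1]mulr1 addr0.
- apply: cvgMl; apply: continuous_comp; first exact: cL.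
  exact: cs'.
Qed.

End class_C1_algebra.

Section cutoff.
Context {R : realType}.

(** The square of the positive part, a C^1 function that is flat to the left of 0. *)
Let psq (x : R) : R := Num.max x 0 * x.

Let dq (x : R) : is_derive x 1 psq (2 * Num.max x 0).
Proof.
have [x0|x0|->] := ltgtP x 0.
- rewrite mulr0; apply: (near_eq_is_derive _ (is_derive_cst (0 : R) x 1)).
  near=> y; rewrite /psq max_r ?mul0r// ltW//; near: y.
  by apply: (cvgr_lt x) => //; exact: cvg_id.
- have d := is_deriveM (is_derive_id x 1) (is_derive_id x 1).
  have -> : 2 * x = x *: 1 + x *: 1 by rewrite [x *: 1]mulr1; ring.
  apply: near_eq_is_derive d.
  near=> y; rewrite /psq max_l// ltW//; near: y.
  by apply: (cvgr_gt x) => //; exact: cvg_id.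
(* At 0 the difference quotient is the positive part itself, continuous with value 0. *)
- rewrite mulr0; apply/is_derive1_caratheodory; exists (fun z => Num.max z 0); split.
  + by move=> z; rewrite /psq mulr0 !subr0.
  + by apply: (@continuous_max _ _ id (cst 0)); [exact: cvg_id|exact: cvg_cst].
  + by rewrite maxxx.
Unshelve. all: by end_near. Qed.

(** A quadratic spline with knots 0, 1/2 and 1: a second difference of [psq], whose derivative is a
    tent supported on [0, 1]. The factor 2 makes the final value 1. *)
Let step (x : R) : R := 2 * (psq x - 2 * psq (x - 2^-1) + psq (x - 1)).
Let step' (x : R) : R :=
  4 * (Num.max x 0 - 2 * Num.max (x - 2^-1) 0 + Num.max (x - 1) 0).

Let step_is_derive (x : R) : is_derive x 1 step (step' x).
Proof.
have dshift (c : R) : is_derive x 1 (psq \o (fun x => x - c)) (2 * Num.max (x - c) 0).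
  have d : is_derive x 1 (fun y : R => y - c) 1.
    rewrite -[X in is_derive _ _ _ X](subr0 1).
    exact: (is_deriveB (is_derive_id x 1) (is_derive_cst c x 1)).
  rewrite -[2 * _]mulr1.
  exact: (@is_derive1_comp _ psq (fun y => y - c) x _ _ (dq (x - c)) d).
have := is_deriveZ (2 : R) (is_deriveD (is_deriveB (dq x)
  (is_deriveZ (2 : R) (dshift 2^-1))) (dshift 1)).
move=> D; apply: (is_derive_eq D); rewrite /step'.
change (2 * (2 * Num.max x 0 - 2 * (2 * Num.max (x - 2^-1) 0) +
  2 * Num.max (x - 1) 0) = 4 * (Num.max x 0 - 2 * Num.max (x - 2^-1) 0 +
  Num.max (x - 1) 0)).
by ring.
Qed.

Let step'_continuous : continuous step'.
Proof.
have cm (c : R) : continuous (fun x : R => Num.max (x - c) 0).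
  move=> x; apply: (@continuous_max _ _ (fun x => x - c) (cst 0)); last exact: cvg_cst.
  by apply: cvgB; [exact: cvg_id|exact: cvg_cst].
have cm0 : continuous (fun x : R => Num.max x 0).
  by move=> x; have := cm 0 x; under eq_fun do rewrite subr0.
move=> x; apply: cvgMr; apply: cvgD; last exact: cm.
by apply: cvgB; [exact: cm0|apply: cvgMr; exact: cm].
Qed.

Let step_le0 x : x <= 0 -> step x = 0.
Proof.
move=> x0; rewrite /step /psq !max_r ?mul0r ?mulr0 ?addr0 ?subr0 ?mulr0//; lra.
Qed.

Let step_ge1 x : 1 <= x -> step x = 1.
Proof. by move=> x1; rewrite /step /psq !max_l; [field|lra|lra|lra]. Qed.

(* A product of four one-dimensional C^1 steps. *)
Lemma cutoff (p : R * R) (rho : R) : 0 < rho ->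
  exists chi : R * R -> R, [/\ class_C 1 setT chi,
    forall q, ball p (rho / 2) q -> chi q = 1 &
    forall q, ~ ball p rho q -> chi q = 0].
Proof.
(* On the half ball each distance to a side of the square is at least [rho / 2], so [k] times it is
   at least 1; outside the ball one of the four is nonpositive and its factor vanishes. *)
move=> rho0; pose k := 2 / rho.
have k0 : 0 < k by rewrite divr_gt0.
have krho : k * rho = 2 by rewrite /k divfK// gt_eqF.
have C (b : bool) (e c : R) : class_C 1 setT
    (step \o (fun q : R * R => k * (rho + e * ((swap b q).1 - c)))).
  apply: (@class_C1_affine _ _ _ _ (fun q => k * (e * (swap b q).1))).
  - exact: step_is_derive.
  - exact: step'_continuous.
  - move=> x v h.
    have -> : (swap b (h *: v + x)).1 = h * (swap b v).1 + (swap b x).1.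
      by rewrite swapD swapZ.
    by ring.
  - move=> x; apply: cvgMr; apply: cvgD; first exact: cvg_cst.
    apply: cvgMr; apply: cvgB; last exact: cvg_cst.
    by apply: (@continuous_comp _ _ _ (swap b) fst);
      [exact: swap_continuous|exact: cvg_fst].
pose f b e c := fun q : R * R => step (k * (rho + e * ((swap b q).1 - c))).
exists (fun q => (f false 1 p.1 q * f false (-1) p.1 q) *
  (f true 1 p.2 q * f true (-1) p.2 q)); split.
- have oT : open [set: R * R] by exact: openT.
  apply: (class_C1M oT); apply: (class_C1M oT).
  + exact: (C false 1 p.1).
  + exact: (C false (-1) p.1).
  + exact: (C true 1 p.2).
  + exact: (C true (-1) p.2).
- move=> q /prod_ball[]; rewrite !ltr_norml => /andP[a1 a2] /andP[b1 b2].
  rewrite /f /= !step_ge1 ?mulr1// -(ler_pM2l rho0) mulr1 mulrA (mulrC rho) krho; lra.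
- move=> q npq.
  have Z (x e : R) : (e = 1 \/ e = -1) -> rho <= - (e * x) -> step (k * (rho + e * x)) = 0.
    move=> e1 ex; apply: step_le0; rewrite pmulr_rle0//; lra.
  have Z2 (x : R) : rho <= `|x| ->
      step (k * (rho + 1 * x)) * step (k * (rho + -1 * x)) = 0.
    have [x0|x0] := ltP 0 x.
      rewrite gtr0_norm// => rx.
      by rewrite [X in _ * X]Z ?mulr0//; [right|lra].
    rewrite ler0_norm// => rx.
    by rewrite [X in X * _]Z ?mul0r//; [left|lra].
  have [q1|q1] := ltP `|p.1 - q.1| rho; last first.
    by rewrite /f /= Z2 ?mul0r// distrC.
  have [q2|q2] := ltP `|p.2 - q.2| rho; last first.
    by rewrite /f /= [X in _ * X]Z2 ?mulr0// distrC.
  by exfalso; apply: npq; apply/prod_ball.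
Qed.

End cutoff.

(** * Area integrals in a chart *)

Section area_chart.
Context {R : realType} (Omega : set (R * R)).
Notation mu := (@lebesgue_measure R).
Hypothesis Oopen : open Omega.
Implicit Types (w f : R * R -> R).

Lemma derive_swap b w v q : 'D_v (w \o swap b) q = 'D_(swap b v) w (swap b q).
Proof.
by apply: derive_line => h /=; rewrite swapD swapZ.
Qed.

Lemma class_C1_swap b w : class_C 1 setT w -> class_C 1 setT (w \o swap b).
Proof.
move=> wC; apply: (@class_C1_intro _ _ _ _ (fun v q => 'D_(swap b v) w (swap b q))).
- exact: openT.
- move=> q _; apply: continuous_comp; first exact: swap_continuous.
  exact: class_C1_continuous.
- move=> v q _; have dw := class_C1_derive (swap b v) wC (I : setT (swap b q)).
  by apply: is_derive_line dw => h /=; rewrite swapD swapZ.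
- move=> v q _; apply: (@continuous_comp _ _ _ (swap b) ('D_(swap b v) w)).
    exact: swap_continuous.
  exact: class_C1_continuousD.
Qed.

Lemma area_integral_swap b D f : measurable D -> continuous f ->
  compactly_supported f ->
  area_integral D f = \int[mu]_x \int[mu]_y (f \_ D) (swap b (x, y)).
Proof.
by move=> mD cf sf; have [_ ? ?] := area_integral_iterated mD cf sf; case: b.
Qed.

Lemma derive_outside w v (p : R * R) (rho r : R) : rho < r ->
  (forall q, ~ ball p rho q -> w q = 0) ->
  forall q, ~ ball p r q -> 'D_v w q = 0.
Proof.
move=> rr w0 q; rewrite -ball_normE /= => /negP; rewrite -leNgt => rq.
rewrite (@near_eq_derive _ _ _ w (cst 0) q v) ?derive_cst//.
have c : `|p - q'| @[q' --> q] --> `|p - q|.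
  by apply: cvg_norm; apply: cvgB; [exact: cvg_cst|exact: cvg_id].
near=> q'; apply: w0; rewrite -ball_normE /=; apply/negP.
rewrite -leNgt ltW//; near: q'.
exact: (cvgr_gt _ c _ (lt_le_trans rr rq)).
Unshelve. all: by end_near. Qed.

(** [Omega] can be replaced by the full side of the graph: the two agree on the ball of radius [r],
    and the derivatives of [w] vanish outside it. The integrals beside a graph then apply to
    [w \o swap b]. *)
Lemma area_chart p b tau phi r rho w : chart Omega p b tau phi r ->
  rho < r -> class_C 1 setT w -> (forall q, ~ ball p rho q -> w q = 0) ->
  area_integral Omega ('D_(swap b (1, 0)) w) =
    \int[mu]_x (tau * 'D_1 phi x * w (swap b (x, phi x))) /\
  area_integral Omega ('D_(swap b (0, 1)) w) =
    \int[mu]_x (- tau * w (swap b (x, phi x))).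
Proof.
move=> ch rr wC w0; have [r0 phiC tau1 H] := ch.
have mO : measurable Omega by exact: open_measurable2.
pose M := `|p| + r.
have out q : M < `|q| -> ~ ball p r q.
  rewrite -ball_normE /= /M => Mq; apply/negP; rewrite -leNgt.
  have := lerB_normD q (- p); rewrite normrN (distrC p).
  by move=> D; apply: le_trans D; rewrite lerBrDl ltW.
have w20 q : M < `|q| -> (w \o swap b) q = 0.
  move=> Mq; apply: w0; rewrite -(swap_norm b) in Mq.
  by move=> /(le_ball (ltW rr)); exact: out.
have w2C := class_C1_swap b wC.
have dphi (x : R) : is_derive x 1 phi ('D_1 phi x) by exact: class_C1_is_derive.
have cphi' : continuous ('D_1 phi : R -> R) by exact: class_C1_continuousD phiC.
have area v : area_integral Omega ('D_(swap b v) w) =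
    \int[mu]_x \int[mu]_y
      (('D_v (w \o swap b)) \_ [set q | 0 < tau * (q.2 - phi q.1)]) (x, y).
  rewrite (area_integral_swap b mO); first last.
  - by exists M => q Mq; apply: (derive_outside _ rr w0); exact: out.
  - exact: class_C1_continuousD.
  apply: eq_Rintegral => x _; apply: eq_Rintegral => y _.
  rewrite !patchE derive_swap.
  have [pb|npb] := pselect (ball p r (swap b (x, y))).
    congr (if _ then _ else _); apply/idP/idP; rewrite !inE /= => XX.
      by move/(H _ pb): XX; rewrite swapK.
    by apply/(H _ pb); rewrite swapK.
  by rewrite (derive_outside _ rr w0 npb) !if_same.
split.
- rewrite area (graph_integral_dx tau1 dphi cphi' w2C w20) -Rintegral_vanish.
    by apply: eq_Rintegral => x _; rewrite mulrA.
  by move=> x Mx; rewrite w20 ?mulr0// prod_normE lt_max Mx.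
- rewrite area (graph_integral_dy phi tau1 w2C w20) -Rintegral_vanish//.
  by move=> x Mx; rewrite w20 ?mulr0// prod_normE lt_max Mx.
Qed.

End area_chart.

(** * The divergence theorem *)

Section divergence.
Context {R : realType} (Omega : set (R * R)) (m : nat) (gamma : 'I_m -> R -> R * R).
Variable n : R * R -> R * R.
Notation mu := (@lebesgue_measure R).
Notation mu2 := (mu \x mu)%E.
Hypothesis Oopen : open Omega.
Hypothesis Obounded : bounded_set Omega.
Hypothesis bp : bdry_param Omega gamma.
Hypothesis nu : outward_unit_normal Omega gamma n.
Hypothesis Obdry : forall p, bdry Omega p -> smooth_bdry_at Omega p.
Implicit Types (w : R * R -> R) (p q : R * R).

(* The x-component for [b = false], the y-component for [b = true]. *)
Definition divergence_identity w := forall b,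
  area_integral Omega ('D_(swap b (1, 0)) w) =
  oint gamma (fun q => w q * (swap b (n q)).1).

Definition supported_in_ball w p (rho : R) := forall q, ~ ball p rho q -> w q = 0.

(** The radius is uniform in [w], because the balls of the cover are fixed before the cutoffs are
    formed. *)
Lemma divergence_bdry p : bdry Omega p -> \forall rho \near 0^'+, forall w,
  class_C 1 setT w -> supported_in_ball w p rho -> divergence_identity w.
Proof.
move=> Bp; have [b [tau [phi [r ch]]]] := smooth_bdry_chart (Obdry Bp).
have [_ _ _ _ im] := bp; have [i0 [s0 ps]] := (im p).1 Bp.
have [r0 phiC _ _] := ch.
have phi'C : continuous ('D_1 phi : R -> R) by exact: class_C1_continuousD phiC.
pose kappa (x : R) := tau * 'D_1 phi x.
have ckappa : continuous kappa by move=> x; apply: cvgMr; exact: phi'C.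
have S q : (swap (~~ b) q).1 = (swap b q).2 by case: (b) q => -[].
have N1 : \forall rho \near 0^'+, forall w : R * R -> R, continuous w ->
    (forall q, ~ ball p rho q -> w q = 0) ->
    oint gamma (fun q => w q * (swap b (n q)).1) =
    \int[mu]_x (kappa x * w (swap b (x, phi x))).
  apply: (oint_chart Oopen bp ch ps ckappa) => [i|s prs].
    exact: (curve_normal_continuous Oopen).
  by have [-> _] := curve_normal_formula Oopen bp nu ch prs; rewrite mulrA.
have N2 : \forall rho \near 0^'+, forall w : R * R -> R, continuous w ->
    (forall q, ~ ball p rho q -> w q = 0) ->
    oint gamma (fun q => w q * (swap (~~ b) (n q)).1) =
    \int[mu]_x (- tau * w (swap b (x, phi x))).
  apply: (oint_chart Oopen bp ch ps (kappa := cst (- tau))) => [|i|s prs].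
  - exact: cst_continuous.
  - exact: (curve_normal_continuous Oopen).
  - by have [_ E] := curve_normal_formula Oopen bp nu ch prs; rewrite S E.
near=> rho => w wC w0.
have rr : rho < r by near: rho; exact: nbhs_right_lt.
have [A1 A2] := area_chart Oopen ch rr wC w0.
have cw := class_C1_continuous wC.
have M1 : oint gamma (fun q => w q * (swap b (n q)).1) =
    \int[mu]_x (kappa x * w (swap b (x, phi x))).
  by move: w cw w0 {wC A1 A2}; near: rho; exact: N1.
have M2 : oint gamma (fun q => w q * (swap (~~ b) (n q)).1) =
    \int[mu]_x (- tau * w (swap b (x, phi x))).
  by move: w cw w0 {wC A1 A2 M1}; near: rho; exact: N2.
move=> b'; have [->|b'b] := eqVneq b' b; first by rewrite A1 M1.
have -> : b' = ~~ b by case: (b') (b) b'b => -[].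
by rewrite M2 -A2; congr (area_integral _ ('D__ _)); case: (b).
Unshelve. all: by end_near. Qed.

(** Both sides vanish. The area integral is handled as in a boundary chart, with a constant graph
    whose derivative is 0; the boundary stays away from the support. *)
Lemma divergence_interior p : Omega p -> \forall rho \near 0^'+, forall w,
  class_C 1 setT w -> supported_in_ball w p rho -> divergence_identity w.
Proof.
move=> Op; have /nbhs_ballP[r /= r0 prO] : nbhs p Omega by exact: open_nbhs_nbhs.
near=> rho => w wC w0 b.
have rr : rho < r by near: rho; exact: nbhs_right_lt.
(* The constant graph at height [c] lies below the ball, so all points of the ball are on its upper
   side, as they are all in [Omega]. *)
pose c := (swap b p).2 - r - 1.
have ch : chart Omega p b 1 (cst c) r.
  split=> //; [|by left|move=> q pq].
    by apply: class_C1_cst; exact: openT.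
  split=> // _; last exact: prO.
  move/(swap_ball b): pq => /prod_ball[_]; rewrite ltr_norml => /andP[_].
  by rewrite mul1r /c /cst; lra.
have [-> _] := area_chart Oopen ch rr wC w0.
have nball q : ~ Omega q -> w q = 0.
  move=> nO; apply: w0 => pq; apply: nO; apply: prO.
  by apply: le_ball pq; exact: ltW.
transitivity (0 : R).
  rewrite -[RHS](mul0r (fine (mu setT))) -Rintegral_cst//.
  by apply: eq_Rintegral => x _; rewrite derive_cst mulr0 mul0r.
rewrite /oint big1// => i _.
rewrite -[RHS](mul0r (fine (mu `[0, 1]))) -Rintegral_cst//.
apply: eq_Rintegral => s _; rewrite nball ?mul0r//.
have [_] := bdry_param_bdry bp i s.
by rewrite (interior_id _).1.
Unshelve. all: by end_near. Qed.

Lemma compact_closure : compact (closure Omega).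
Proof.
have [M _ OM] := pinfty_ex_gt0 Obounded.
have cK := @ball0_compact R M.
apply: (subclosed_compact _ cK); first exact: closed_closure.
rewrite [X in _ `<=` X](closure_id _).1; first exact: closureS.
by apply: compact_closed cK; exact: norm_hausdorff.
Qed.

Section neighbourhood.
Variable V : set (R * R).
Hypothesis oV : open V.
Hypothesis OV : closure Omega `<=` V.

Let gV i s : V (gamma i s).
Proof. by apply: OV; have [] := bdry_param_bdry bp i s. Qed.

Lemma class_C1_derive_integrable w v : class_C 1 V w ->
  mu2.-integrable Omega (EFin \o 'D_v w).
Proof.
move=> wC.
have cD p : V p -> {for p, continuous ('D_v w)} by exact: class_C1_contD.
have [M DM] := compact_norm_bounded compact_closure (fun p Cp => cD p (OV Cp)).
apply: (@bounded_integrable2 _ _ _ M) => //.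
- exact: open_measurable2.
- by apply: continuous_measurable2 => // p Op; apply/cD/OV/subset_closure.
- by move=> p Op; apply/DM/subset_closure.
Qed.

Lemma class_C1_oint_integrable w b i : class_C 1 V w ->
  mu.-integrable `[0, 1] (EFin \o (fun s =>
    w (gamma i s) * (swap b (n (gamma i s))).1 * enorm (derive1 (gamma i) s))).
Proof.
move=> wC; apply: continuous_integrable.
have cwg : continuous (fun s => w (gamma i s)).
  move=> s; apply: (@continuous_comp _ _ _ (gamma i) w).
    by have [sm _ _ _ _] := bp; exact: (class_C1_continuous (sm i 1%N)).
  exact: class_C1_cont wC (gV i s).
have cN : continuous (fun s =>
    (swap b (n (gamma i s))).1 * enorm (derive1 (gamma i) s)).
  exact: (curve_normal_continuous Oopen).
by move=> s; under eq_fun do rewrite -mulrA; apply: cvgM; [exact: cwg|exact: cN].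
Qed.

Lemma divergence_identityD w1 w2 : class_C 1 V w1 -> class_C 1 V w2 ->
  divergence_identity w1 -> divergence_identity w2 ->
  divergence_identity (fun q => w1 q + w2 q).
Proof.
move=> C1 C2 I1 I2 b; set v := swap b (1, 0).
have VO p : Omega p -> V p by move=> Op; apply/OV/subset_closure.
transitivity (area_integral Omega ('D_v w1) + area_integral Omega ('D_v w2)).
  rewrite /area_integral -RintegralD; first last.
  - exact: class_C1_derive_integrable.
  - exact: class_C1_derive_integrable.
  - exact: open_measurable2.
  apply: eq_Rintegral => p; rewrite inE => /VO Vp.
  have [_ E] := is_deriveD (class_C1_derive v C1 Vp) (class_C1_derive v C2 Vp).
  exact: E.
rewrite I1 I2 /oint -big_split; apply: eq_bigr => i _ /=.
rewrite -RintegralD//; [|exact: class_C1_oint_integrable..].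
by apply: eq_Rintegral => s _; rewrite !mulrDl.
Qed.

Lemma divergence_identity0 w : (forall q, closure Omega q -> w q = 0) ->
  divergence_identity w.
Proof.
move=> w0 b; transitivity (0 : R).
  rewrite -[RHS](mul0r (fine (mu2 Omega))) -Rintegral_cst; last exact: open_measurable2.
  apply: eq_Rintegral => p; rewrite inE => Op.
  rewrite (@near_eq_derive _ _ _ w (cst 0)) ?derive_cst//.
  have := open_nbhs_nbhs (conj Oopen Op); apply: filterS => q Oq.
  exact/w0/subset_closure.
rewrite /oint big1// => i _.
rewrite -[RHS](mul0r (fine (mu `[0, 1]))) -Rintegral_cst//.
apply: eq_Rintegral => s _; rewrite w0 ?mul0r//.
by have [] := bdry_param_bdry bp i s.
Qed.

(** Doubling the radius puts the closed ball inside [V], so that a cutoff supported there times a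
    C^1 function on [V] is C^1 on the whole plane. *)
Definition good_ball (P : (R * R) * R) := [/\ 0 < P.2,
  forall q, ball P.1 (2 * P.2) q -> V q &
  forall w, class_C 1 setT w -> supported_in_ball w P.1 P.2 -> divergence_identity w].

Lemma good_ball_ex p : closure Omega p -> exists rho, good_ball (p, rho).
Proof.
move=> Cp.
have D : \forall rho \near 0^'+, forall w,
    class_C 1 setT w -> supported_in_ball w p rho -> divergence_identity w.
  have [Op|nOp] := pselect (Omega p); first exact: divergence_interior.
  by apply: divergence_bdry; split=> //; rewrite (interior_id _).1.
have /nbhs_ballP[r /= r0 prV] : nbhs p V by apply: open_nbhs_nbhs; split => //; exact: OV.
have F : \forall rho \near 0^'+, good_ball (p, rho).
  near=> rho; split; [|move=> q /= pq|].
  - by near: rho; exact: nbhs_right_gt.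
  - apply: prV; apply: le_ball pq.
    rewrite -ler_pdivlMl// mulrC; near: rho; apply: nbhs_right_le.
    by rewrite divr_gt0.
  - by near: rho; exact: D.
have [rho Hrho] := @filter_ex _ (0 : R)^'+ _ _ F.
by exists rho.
Unshelve. all: by end_near. Qed.

(* Peel off one ball at a time with a cutoff equal to 1 on the half ball. *)
Lemma divergence_cover (l : seq ((R * R) * R)) w :
  (forall P, P \in l -> good_ball P) -> class_C 1 V w ->
  (forall q, closure Omega q -> (forall P, P \in l -> ~ ball P.1 (P.2 / 2) q) ->
    w q = 0) ->
  divergence_identity w.
Proof.
elim: l w => [|[p rho] l IH] w lg wC w0.
  by apply: divergence_identity0 => q Cq; exact: w0.
have [/= rho0 pV good] := lg (p, rho) (mem_head _ _).
have [chi [chiC chi1 chi0]] := cutoff p rho0.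
have chiV : class_C 1 V chi by exact: class_C1_subset chiC.
have C1 : class_C 1 V (fun q => chi q * w q) by exact: (class_C1M oV chiV wC).
have C2 : class_C 1 V (fun q => (1 + -1 * chi q) * w q).
  have c1 := class_C1_cst (1 : R) oV; have cN1 := class_C1_cst (-1 : R) oV.
  exact: (class_C1M oV (class_C1D oV c1 (class_C1M oV cN1 chiV)) wC).
rewrite (_ : w = fun q => chi q * w q + (1 + -1 * chi q) * w q); last first.
  by apply/funext => q; ring.
apply: (divergence_identityD C1 C2).
- apply: good; last by move=> q nq; rewrite chi0 ?mul0r.
  (* On [U] the product is zero, and [V] together with [U] is the plane; this gives the global
     regularity required by [good]. *)
  pose U := [set q | rho < `|p - q|].
  have oU : open U.
    apply: (@open_comp _ _ (fun q => `|p - q|) [set x | rho < x]); last exact: open_gt.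
    by move=> q _; apply: cvg_norm; apply: cvgB; [exact: cvg_cst|exact: cvg_id].
  apply: (@class_C1_subset _ _ _ (V `|` U)) => [q _|].
    have [qU|qU] := ltP rho `|p - q|; [by right|left; apply: pV].
    by rewrite -ball_normE /= (le_lt_trans qU)// ltr_pMl// ltr1n.
  apply: (class_C1_setU C1).
  apply: (@class_C1_eq _ _ _ (cst 0)) (class_C1_cst 0 oU) => // q qU.
  by rewrite chi0 ?mul0r// -ball_normE /=; apply/negP; rewrite -leNgt ltW.
- apply: IH; [|exact: C2|].
  + by move=> P Pl; apply: lg; rewrite in_cons Pl orbT.
  (* On the removed half ball [1 - chi] vanishes; off it, the assumption on [w] applies. *)
  + move=> q Cq nq; have [pq|npq] := pselect (ball p (rho / 2) q).
      by rewrite chi1//; ring.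
    rewrite w0 ?mulr0// => P; rewrite in_cons => /predU1P[->//|].
    exact: nq.
Qed.

Theorem divergence w : class_C 1 V w -> divergence_identity w.
Proof.
(* Compactness of the closure, along the filter of lists of good balls. *)
move=> wC; pose good (l : seq (R * R * R)) := forall P, P \in l -> good_ball P.
pose F := filter_from [set l | good l]
  (fun l0 : seq (R * R * R) => [set l | good l /\ {subset l0 <= l}]).
have FF : ProperFilter F.
  apply: filter_from_proper.
    apply: filter_from_filter; first by exists [::] => P; rewrite in_nil.
    move=> l1 l2 g1 g2; exists (l1 ++ l2).
      by move=> P; rewrite mem_cat => /orP[/g1|/g2].
    by move=> l [gl sl]; split; split=> // P Pl; apply: sl;
      rewrite mem_cat Pl ?orbT.
  by move=> l gl; exists l; split.
pose covers (l : seq (R * R * R)) q := exists2 P, P \in l & ball P.1 (P.2 / 2) q.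
have : \forall l \near F, closure Omega `<=` covers l.
  move/compact_near_coveringP: compact_closure; apply=> q Cq.
  have [rho grho] := good_ball_ex Cq.
  exists (ball q (rho / 2),
    [set l : seq (R * R * R) | good l /\ {subset [:: (q, rho)] <= l}]).
    split; first by apply: nbhsx_ballx; rewrite divr_gt0//; case: grho.
    by exists [:: (q, rho)] => // P; rewrite mem_seq1 => /eqP ->.
  move=> [q' l] /= [qq' [_ sl]]; exists (q, rho) => //.
  by apply: sl; rewrite mem_seq1.
move=> Fcov.
have Fgood : \forall l \near F, good l.
  by exists [::] => [P|l []//]; rewrite in_nil.
have [l [cl gl]] := filter_ex (filterI Fcov Fgood).
apply: (@divergence_cover l) => // q /cl[P Pl Pq] /(_ P Pl).
by move=> /(_ Pq).
Qed.

End neighbourhood.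
End divergence.

(** * The energy balance *)

Section space_time.
Context {R : realType} (Omega : set (R * R)).
Notation mu := (@lebesgue_measure R).
Notation mu2 := (mu \x mu)%E.
Implicit Types (U : set (R * (R * R))) (f : R * (R * R) -> R).

Lemma is_derive_time f (t : R) (p : R * R) d : is_derive (t, p) (1, 0) f d ->
  is_derive t 1 (fun s => f (s, p)) d.
Proof.
apply: is_derive_line => h; congr f; congr pair => /=.
by rewrite [h *: 0]scaler0 add0r.
Qed.

Lemma class_C1_slice U f (t : R) : open U -> class_C 1 U f ->
  class_C 1 [set p | U (t, p)] (fun p => f (t, p)).
Proof.
move=> oU fC.
have ct : continuous (fun p : R * R => (t, p)).
  by move=> p; apply: continuous_pair_at; [exact: cvg_cst|exact: cvg_id].
apply: (@class_C1_intro _ _ _ _ (fun v p => 'D_(0, v) f (t, p))).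
- by apply: open_comp => // p _; exact: ct.
- move=> p Up; apply: (@continuous_comp _ _ _ (fun p => (t, p)) f); first exact: ct.
  exact: class_C1_cont fC Up.
- move=> v p Up; have := class_C1_derive (0, v) fC Up.
  apply: is_derive_line => h; congr f; congr pair => /=.
  by rewrite [h *: 0]mulr0 add0r.
- move=> v p Up; apply: (@continuous_comp _ _ _ (fun p => (t, p)) ('D_(0, v) f)).
    exact: ct.
  exact: class_C1_contD fC Up.
Qed.

Hypothesis Oopen : open Omega.
Hypothesis Obounded : bounded_set Omega.

Lemma tube U (t : R) : open U -> (forall p, closure Omega p -> U (t, p)) ->
  \forall s \near t, forall p, closure Omega p -> U (s, p).
Proof.
move=> oU OU.
move/compact_near_coveringP: (compact_closure Obounded).
move=> /(_ _ (nbhs t) (fun s p => U (s, p)) _); apply => p Cp.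
have [[A B] /= [nA nB] AB] : nbhs (t, p) U.
  by apply: open_nbhs_nbhs; split => //; exact: OU.
by exists (B, A) => // -[q s] [/= Bq As]; exact: (AB (s, q)).
Qed.

(** On a compact slab around time [t] the time derivative is bounded by a constant, which is
    integrable on the bounded set [Omega]. Since [U] is a neighbourhood of the whole slice, t = 0 is
    allowed. *)
Lemma area_integral_derive U f (t : R) : open U -> class_C 1 U f ->
  (forall p, closure Omega p -> U (t, p)) ->
  is_derive t 1 (fun s => area_integral Omega (fun p => f (s, p)))
    (area_integral Omega (fun p => 'D_(1, 0) f (t, p))).
Proof.
move=> oU fC OU.
have /nbhs_ballP[e /= e0 eU] := tube oU OU.
have e20 : 0 < e / 2 by rewrite divr_gt0.
pose K : set (R * (R * R)) := `[t - e / 2, t + e / 2] `*` closure Omega.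
have cK : compact K.
  by apply: compact_setX; [exact: segment_compact|exact: compact_closure].
have KU z : K z -> U z.
  case: z => s p [/= sI Cp]; apply: eU => //.
  move: sI; rewrite in_itv/= -ler_distl /ball/= distrC => st.
  by rewrite (le_lt_trans st)// ltr_pdivrMr// ltr_pMr// ltr1n.
have cD z : K z -> {for z, continuous ('D_(1, 0) f)}.
  by move=> /KU; exact: class_C1_contD.
have [M fM] := compact_norm_bounded cK cD.
have [N fN] := compact_norm_bounded cK (fun z Kz => class_C1_cont fC (KU z Kz)).
have IK s p : `]t - e / 2, t + e / 2[%classic s -> Omega p -> K (s, p).
  by move=> sI Op; split=> /=; [exact: subset_itv_oo_cc|exact: subset_closure].
have mO := open_measurable2 Oopen.
have It : `]t - e / 2, t + e / 2[%classic t.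
  by rewrite /= in_itv/= ltrBlDr !ltrDl e20.
have intf s : `]t - e / 2, t + e / 2[%classic s ->
    mu2.-integrable Omega (EFin \o (fun p => f (s, p))).
  move=> Is; apply: (@bounded_integrable2 _ _ _ N) => //; last first.
    by move=> p Op; exact/fN/IK.
  apply: continuous_measurable2 => // p Op.
  apply: class_C1_cont (class_C1_slice s oU fC) _.
  exact/KU/IK.
have d1 s p : `]t - e / 2, t + e / 2[%classic s -> Omega p ->
    is_derive s 1 (fun s => f (s, p)) ('D_(1, 0) f (s, p)).
  by move=> Is Op; apply: is_derive_time; exact: class_C1_derive (KU _ (IK _ _ Is Op)).
have derf s p : `]t - e / 2, t + e / 2[%classic s -> Omega p ->
    derivable ((fun s p => f (s, p))^~ p) s 1.
  by move=> Is Op; have [] := d1 s p Is Op.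
have M0 : 0 <= `|M| by [].
have iM : mu2.-integrable Omega (EFin \o (cst `|M|)).
  apply: (@bounded_integrable2 _ _ _ `|M|) => //.
  by move=> p _; rewrite /= normr_id.
have Gub s p : `]t - e / 2, t + e / 2[%classic s -> Omega p ->
    `|partial1of2 (fun s p => f (s, p)) s p| <= cst `|M| p.
  move=> Is Op; rewrite partial1of2E; have [_ ->] := d1 s p Is Op.
  by rewrite (le_trans (fM _ (IK _ _ Is Op)))// ler_norm.
have dF := @derivable_under_integral _ _ _ mu2 (fun s p => f (s, p)) Omega mO
  t _ _ It intf derf (cst `|M|) (fun=> M0) iM Gub.
have F' := @differentiation_under_integral _ _ _ mu2 (fun s p => f (s, p)) Omega mO
  t _ _ It intf derf (cst `|M|) (fun=> M0) iM Gub.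
apply: DeriveDef; first exact: dF.
rewrite -derive1E [LHS]F'; apply: eq_Rintegral => p; rewrite inE => Op.
by rewrite partial1of2E; have [_ ->] := d1 t p It Op.
Qed.

End space_time.

(** * Pointwise energy identities and the sign of the boundary flux *)

Section shallow_water_calculus.
Context {R : realType} {V : normedModType R} (g : R).
Implicit Types (h u v : V -> R).

Definition density (h u v : R) : R := h * (u ^+ 2 + v ^+ 2) / 2 + g * h ^+ 2 / 2.

Lemma class_C1_potG (U : set V) h u v : open U ->
  class_C 1 U h -> class_C 1 U u -> class_C 1 U v ->
  class_C 1 U (fun q => potG g (h q) (u q) (v q)).
Proof.
move=> oU hC uC vC.
have ch := class_C1_cst (2^-1 : R) oU; have cg := class_C1_cst g oU.
have := class_C1D oU (class_C1M oU (class_C1D oU (class_C1M oU uC uC)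
  (class_C1M oU vC vC)) ch) (class_C1M oU cg hC).
by apply: class_C1_eq => // x _; rewrite /potG.
Qed.

Lemma class_C1_density (U : set V) h u v : open U ->
  class_C 1 U h -> class_C 1 U u -> class_C 1 U v ->
  class_C 1 U (fun q => density (h q) (u q) (v q)).
Proof.
move=> oU hC uC vC.
have ch := class_C1_cst (2^-1 : R) oU; have cg := class_C1_cst g oU.
have := class_C1D oU (class_C1M oU (class_C1M oU hC (class_C1D oU
  (class_C1M oU uC uC) (class_C1M oU vC vC))) ch)
  (class_C1M oU (class_C1M oU cg (class_C1M oU hC hC)) ch).
by apply: class_C1_eq => // x _; rewrite /density.
Qed.

Section at_point.
Variables (h u v : V -> R) (x d : V) (h' u' v' : R).
Hypothesis dh : is_derive x d h h'.
Hypothesis du : is_derive x d u u'.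
Hypothesis dv : is_derive x d v v'.

Lemma is_derive_potG : is_derive x d (fun q => potG g (h q) (u q) (v q))
  (u x * u' + v x * v' + g * h').
Proof.
rewrite (_ : (fun q => _) = 2^-1 \*: (u * u + v * v) + g \*: h).
  apply: is_derive_eq (is_deriveD (is_deriveZ 2^-1 (is_deriveD (is_deriveM du du)
    (is_deriveM dv dv))) (is_deriveZ g dh)) _.
  change (2^-1 * ((u x * u' + u x * u') + (v x * v' + v x * v')) + g * h' =
    u x * u' + v x * v' + g * h').
  by field.
apply/funext => q.
change ((u q ^+ 2 + v q ^+ 2) / 2 + g * h q =
  2^-1 * (u q * u q + v q * v q) + g * h q).
by field.
Qed.

Lemma is_derive_density : is_derive x d (fun q => density (h q) (u q) (v q))
  (potG g (h x) (u x) (v x) * h' + h x * (u x * u' + v x * v')).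
Proof.
rewrite (_ : (fun q => _) = 2^-1 \*: (h * (u * u + v * v)) + (g / 2) \*: (h * h)).
  apply: is_derive_eq (is_deriveD (is_deriveZ 2^-1 (is_deriveM dh (is_deriveD
    (is_deriveM du du) (is_deriveM dv dv)))) (is_deriveZ (g / 2) (is_deriveM dh dh))) _.
  change (2^-1 * (h x * ((u x * u' + u x * u') + (v x * v' + v x * v')) +
    (u x * u x + v x * v x) * h') + (g / 2) * (h x * h' + h x * h') =
    potG g (h x) (u x) (v x) * h' + h x * (u x * u' + v x * v')).
  by rewrite /potG; field.
apply/funext => q; rewrite /density !fctE /=.
change (h q * (u q ^+ 2 + v q ^+ 2) / 2 + g * h q ^+ 2 / 2 =
  2^-1 * (h q * (u q * u q + v q * v q)) + g / 2 * (h q * h q)).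
by field.
Qed.

End at_point.
End shallow_water_calculus.

(** Stated for nonnegative [h], which is what positivity inside [Omega] gives on the boundary by
    continuity. *)
Lemma bdry_flux_ge0 (R : realType) (g a b : R) (n : R * R) (h u v : R) :
  0 < g -> 0 <= h -> 0 <= a -> 0 <= b -> 0 < `|a| ^+ 2 + `|b| ^+ 2 ->
  bdry_cond g a b n h u v -> 0 <= potG g h u v * fluxFn n h u v.
Proof.
move=> g0 h0 a0 b0 ab [inflow _].
have G0 : 0 <= potG g h u v.
  rewrite /potG addr_ge0//; last by rewrite mulr_ge0// ltW.
  by rewrite mulr_ge0 ?invr_ge0// addr_ge0 ?sqr_ge0.
apply: mulr_ge0 => //; rewrite /fluxFn.
have [un0|] := ltP (normal_vel n u v) 0; last exact: mulr_ge0.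
have [E _] := inflow un0; move: E; rewrite /potGn /fluxFn.
set un := normal_vel n u v in un0 *.
(* At inflow strict positivity comes from the nonzero normal velocity, since [h] may be 0 here. *)
have Gn0 : 0 < un ^+ 2 / 2 + g * h.
  rewrite ltr_pwDl ?mulr_ge0 ?(ltW g0)//.
  by rewrite divr_gt0// exprn_even_gt0//= lt_eqF.
have [aE|aN0] := eqVneq a 0.
  have bN0 : b != 0.
    by apply: contraTneq ab => ->; rewrite aE normr0 expr0n/= addr0 ltxx.
  move/eqP; rewrite aE mul0r sub0r oppr_eq0 mulf_eq0 (negbTE bN0)/= => /eqP ->.
  by [].
have aG : 0 < a * (un ^+ 2 / 2 + g * h) by rewrite mulr_gt0// lt0r aN0.
have bF : b * (h * un) <= 0 by rewrite mulr_ge0_le0// mulr_ge0_le0// ltW.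
by move/eqP; rewrite subr_eq0 => /eqP E; move: aG; rewrite E ltNge bF.
Qed.

Lemma near_lt_ereal (R : realType) (T : \bar R) (t : R) : (t%:E < T)%E ->
  \forall s \near t, (s%:E < T)%E.
Proof.
case: T => [r| |//]; last by move=> _; near=> s; exact: ltry.
rewrite lte_fin => tr; near=> s; rewrite lte_fin; near: s.
by apply: (cvgr_lt t) => //; exact: cvg_id.
Unshelve. all: by end_near. Qed.

(** The mass equation is multiplied by G and the two velocity equations by h u and h v. The terms
    with the vorticity cancel, since the rotated velocity is orthogonal to the velocity. *)
Lemma energy_algebra (R : comRingType) (h u v G ht ut vt w mx my Gx Gy : R) :
  ht + (mx + my) = 0 -> ut - w * v + Gx = 0 -> vt + w * u + Gy = 0 ->
  G * ht + h * (u * ut + v * vt) =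
  - (G * mx + h * u * Gx + (G * my + h * v * Gy)).
Proof.
move=> E1 E2 E3; apply/eqP; rewrite -subr_eq0; apply/eqP.
transitivity (G * (ht + (mx + my)) + h * u * (ut - w * v + Gx) +
  h * v * (vt + w * u + Gy)); first by ring.
by rewrite E1 E2 E3 !mulr0 !addr0.
Qed.

Lemma energy_balance (R : realType) (g fc t : R) (p : R * R) (h u v : R -> R * R -> R) :
  derivable (h ^~ p) t 1 -> derivable (u ^~ p) t 1 -> derivable (v ^~ p) t 1 ->
  (forall e, derivable (h t) p e) -> (forall e, derivable (u t) p e) ->
  (forall e, derivable (v t) p e) -> sw_eqs g fc h u v t p ->
  is_derive t 1 (fun s => density g (h s p) (u s p) (v s p))
   (- ('D_(1, 0) (fun q => potG g (h t q) (u t q) (v t q) * (h t q * u t q)) p +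
       'D_(0, 1) (fun q => potG g (h t q) (u t q) (v t q) * (h t q * v t q)) p)).
Proof.
move=> ht ut vt hp up vp [] /=.
set G := fun q => potG g (h t q) (u t q) (v t q).
have dG e : is_derive p e G ('D_e G p).
  apply: derivableP.
  by have [] := is_derive_potG g (derivableP (hp e)) (derivableP (up e))
    (derivableP (vp e)).
have dprod (k : R * R -> R) e : derivable k p e ->
    'D_e (fun q => G q * (h t q * k q)) p =
    G p * 'D_e (fun q => h t q * k q) p + h t p * k p * 'D_e G p.
  move=> kp.
  have dk : is_derive p e (fun q => h t q * k q) ('D_e (fun q => h t q * k q) p).
    by apply: derivableP; exact: (@derivableM _ _ (h t) k p e (hp e) kp).
  by have [_ E] := is_deriveM (dG e) dk; exact: E.
have Ex := dprod (u t) (1, 0) (up (1, 0)).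
have Ey := dprod (v t) (0, 1) (vp (0, 1)).
rewrite /dx /dy /dt !derive1E.
have dens := is_derive_density g (derivableP ht) (derivableP ut) (derivableP vt).
move=> E1 E2 E3; apply: (is_derive_eq dens).
transitivity (- (G p * 'D_(1, 0) (fun q => h t q * u t q) p +
    h t p * u t p * 'D_(1, 0) G p +
    (G p * 'D_(0, 1) (fun q => h t q * v t q) p +
    h t p * v t p * 'D_(0, 1) G p))); last first.
  by congr (- (_ + _)); apply: esym; [exact: Ex|exact: Ey].
rewrite -/(G p); move: E1 E2 E3.
exact: energy_algebra.
Qed.

(** * From the smooth extensions to the solution *)

Section solution.
Context {R : realType} (g fc : R) (Omega : set (R * R)).
Notation mu := (@lebesgue_measure R).
Context (m : nat) (gamma : 'I_m -> R -> R * R) (n : R * R -> R * R) (T : \bar R).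
Context (h u v : R -> R * R -> R).
Hypothesis Oopen : open Omega.
Hypothesis Obounded : bounded_set Omega.
Hypothesis Obdry : forall p, bdry Omega p -> smooth_bdry_at Omega p.
Hypothesis bp : bdry_param Omega gamma.
Hypothesis nu : outward_unit_normal Omega gamma n.
Hypothesis sw : forall (t : R) p, 0 < t -> (t%:E < T)%E -> Omega p ->
  sw_eqs g fc h u v t p.

Variables (U : set (R * (R * R))) (H A B : R * (R * R) -> R).
Hypothesis oU : open U.
Hypothesis SU : spacetime T Omega `<=` U.
Hypothesis HC : class_C 1 U H.
Hypothesis AC : class_C 1 U A.
Hypothesis BC : class_C 1 U B.
Hypothesis Hh : forall z, spacetime T Omega z -> H z = h z.1 z.2.
Hypothesis Au : forall z, spacetime T Omega z -> A z = u z.1 z.2.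
Hypothesis Bv : forall z, spacetime T Omega z -> B z = v z.1 z.2.

Let st (t : R) p : 0 <= t -> (t%:E < T)%E -> closure Omega p ->
  spacetime T Omega (t, p).
Proof. by []. Qed.

Let stO (t : R) p : 0 <= t -> (t%:E < T)%E -> Omega p -> spacetime T Omega (t, p).
Proof. by move=> t0 tT Op; apply: st => //; exact: subset_closure. Qed.

(** The hypotheses leave [h], [u], [v] arbitrary at negative times; the energy of the extensions has
    a two-sided derivative even at t = 0. *)
Definition extended_energy (t : R) :=
  area_integral Omega (fun p => density g (H (t, p)) (A (t, p)) (B (t, p))).

Lemma extended_energyE (t : R) : 0 <= t -> (t%:E < T)%E ->
  energy g Omega h u v t = extended_energy t.
Proof.
move=> t0 tT; apply: eq_Rintegral => p; rewrite inE => Op.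
by rewrite Hh ?Au ?Bv//; exact: stO.
Qed.

Let densC := class_C1_density g oU HC AC BC.

Lemma extended_energy_derive (t : R) : 0 <= t -> (t%:E < T)%E ->
  is_derive t 1 extended_energy (area_integral Omega (fun p =>
    'D_(1, 0) (fun z => density g (H z) (A z) (B z)) (t, p))).
Proof.
move=> t0 tT; apply: (area_integral_derive Oopen Obounded oU densC) => p Cp.
exact/SU/st.
Qed.

Let field_time (f : R -> R * R -> R) (F : R * (R * R) -> R) (t : R) p :
  class_C 1 U F -> (forall z, spacetime T Omega z -> F z = f z.1 z.2) ->
  0 < t -> (t%:E < T)%E -> Omega p ->
  (\forall s \near t, F (s, p) = f s p) /\ derivable (f ^~ p) t 1.
Proof.
move=> FC Ff t0 tT Op.
have E : \forall s \near t, F (s, p) = f s p.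
  near=> s; apply: (Ff (s, p)); apply: stO => //.
    apply: ltW; near: s; apply: (cvgr_gt t) => //; exact: cvg_id.
  by near: s; exact: near_lt_ereal.
split=> //; apply: near_eq_derivable E _.
have Utp : U (t, p) by apply/SU/stO => //; exact: ltW.
by have [] := is_derive_time (class_C1_derive ((1, 0) : R * (R * R)) FC Utp).
Unshelve. all: by end_near. Qed.

Let field_space (f : R -> R * R -> R) (F : R * (R * R) -> R) (t : R) p :
  class_C 1 U F -> (forall z, spacetime T Omega z -> F z = f z.1 z.2) ->
  0 < t -> (t%:E < T)%E -> Omega p ->
  (\forall q \near p, F (t, q) = f t q) /\ (forall e, derivable (f t) p e).
Proof.
move=> FC Ff t0 tT Op.
have E : \forall q \near p, F (t, q) = f t q.
  have := open_nbhs_nbhs (conj Oopen Op); apply: filterS => q Oq.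
  by apply: (Ff (t, q)); apply: stO => //; exact: ltW.
split=> // e; apply: near_eq_derivable E _.
have Utp : U (t, p) by apply/SU/stO => //; exact: ltW.
by have [] := class_C1_derive e (class_C1_slice t oU FC) Utp.
Qed.

(** The balance law holds for [h], [u], [v] at interior points, whereas the divergence theorem needs
    functions that are C^1 near the closure. The two agree near every interior point at positive
    time, so derivatives can be exchanged there. *)
Lemma bdry_term_extended (t : R) : 0 < t -> (t%:E < T)%E ->
  area_integral Omega (fun p =>
    'D_(1, 0) (fun z => density g (H z) (A z) (B z)) (t, p)) =
  bdry_term g gamma n h u v t.
Proof.
move=> t0 tT; have t0' := ltW t0.
pose V := [set p | U (t, p)].
have oV : open V.
  apply: open_comp => // p _.
  by apply: continuous_pair_at; [exact: cvg_cst|exact: cvg_id].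
have OV : closure Omega `<=` V by move=> p Cp; exact/SU/st.
have hV := class_C1_slice t oU HC; have uV := class_C1_slice t oU AC.
have vV := class_C1_slice t oU BC; have GV := class_C1_potG g oV hV uV vV.
pose W (k : R * R -> R) q := potG g (H (t, q)) (A (t, q)) (B (t, q)) * (H (t, q) * k q).
have WC k : class_C 1 V k -> class_C 1 V (W k).
  by move=> kV; apply: (class_C1M oV GV); exact: (class_C1M oV hV kV).
pose W1 := W (fun q => A (t, q)); pose W2 := W (fun q => B (t, q)).
have W1C : class_C 1 V W1 := WC _ uV.
have W2C : class_C 1 V W2 := WC _ vV.
have E p : Omega p -> 'D_(1, 0) (fun z => density g (H z) (A z) (B z)) (t, p) =
    - ('D_(1, 0) W1 p + 'D_(0, 1) W2 p).
  move=> Op.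
  have [th dth] := field_time HC Hh t0 tT Op; have [tu dtu] := field_time AC Au t0 tT Op.
  have [tv dtv] := field_time BC Bv t0 tT Op.
  have [sh dsh] := field_space HC Hh t0 tT Op; have [su dsu] := field_space AC Au t0 tT Op.
  have [sv dsv] := field_space BC Bv t0 tT Op.
  have Utp : U (t, p) by apply/OV/subset_closure.
  have [_ <-] := is_derive_time (class_C1_derive ((1, 0) : R * (R * R)) densC Utp).
  have [_ bal] := energy_balance dth dtu dtv dsh dsu dsv (sw t0 tT Op).
  transitivity ('D_1 (fun s => density g (h s p) (u s p) (v s p)) t).
    apply: near_eq_derive; near=> s.
    by congr (density g _ _ _); near: s.
  rewrite bal; congr (- (_ + _)); apply: near_eq_derive; near=> q.
    have -> : h t q = H (t, q) by apply/esym; near: q.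
    have -> : u t q = A (t, q) by apply/esym; near: q.
    by have -> : v t q = B (t, q) by apply/esym; near: q.
  have -> : h t q = H (t, q) by apply/esym; near: q.
  have -> : u t q = A (t, q) by apply/esym; near: q.
  by have -> : v t q = B (t, q) by apply/esym; near: q.
have div w : class_C 1 V w -> divergence_identity Omega gamma n w.
  exact: (divergence Oopen Obounded bp nu Obdry oV OV).
have i1 := class_C1_derive_integrable Oopen Obounded OV (1, 0) W1C.
have i2 := class_C1_derive_integrable Oopen Obounded OV (0, 1) W2C.
have mO := open_measurable2 Oopen.
transitivity (- (area_integral Omega ('D_(1, 0) W1) + area_integral Omega ('D_(0, 1) W2))).
  rewrite /area_integral -RintegralD// -[RHS]mulN1r -RintegralZl//; last first.
    exact: (@integrableD _ _ R (mu \x mu)%E _ mO _ _ i1 i2).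
  by apply: eq_Rintegral => p; rewrite inE mulN1r; exact: E.
(* [false] selects the x-component of the normal and [true] the y-component; their sum is the normal
   flux. *)
have /= -> := div W1 W1C false; have /= -> := div W2 W2C true.
rewrite /bdry_term /oint -big_split; congr (- _); apply: eq_bigr => i _ /=.
have j1 := class_C1_oint_integrable Oopen bp nu Obdry OV false i W1C.
have j2 := class_C1_oint_integrable Oopen bp nu Obdry OV true i W2C.
rewrite -RintegralD//; apply: eq_Rintegral => s _.
have Cs : closure Omega (gamma i s) by have [] := bdry_param_bdry bp i s.
have S := st t0' tT Cs.
rewrite /W1 /W2 /W (Hh S) (Au S) (Bv S) /= /fluxFn /normal_vel.
by ring.
Unshelve. all: by end_near. Qed.

End solution.

Lemma closure_ge0 (R : realType) (T : topologicalType) (A : set T) (f : T -> R) :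
  (forall p, closure A p -> {for p, continuous f}) ->
  (forall p, A p -> 0 <= f p) -> forall p, closure A p -> 0 <= f p.
Proof.
move=> cf f0 p Cp; rewrite leNgt; apply/negP => fp.
have [q [Aq fq]] := Cp _ (cvgr_lt (f p) (cf p Cp) 0 fp).
by move: (f0 q Aq); rewrite leNgt fq.
Qed.

Lemma bdry_term_le0 (R : realType) (g t : R) (m : nat) (gamma : 'I_m -> R -> R * R)
    (n : R * R -> R * R) (h u v : R -> R * R -> R) :
  (forall i s p, p = gamma i s ->
    0 <= potG g (h t p) (u t p) (v t p) * fluxFn (n p) (h t p) (u t p) (v t p)) ->
  bdry_term g gamma n h u v t <= 0.
Proof.
move=> flux; rewrite oppr_le0; apply: sumr_ge0 => i _; apply: Rintegral_ge0 => s _.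
by apply: mulr_ge0; [exact: flux erefl|exact: sqrtr_ge0].
Qed.

Theorem theorem4 (R : realType) (g fc : R)
    (Omega : set (R * R)) (m : nat) (gamma : 'I_m -> R -> R * R)
    (n : R * R -> R * R) (T : \bar R)
    (h u v : R -> R * R -> R) (h0 u0 v0 : R * R -> R)
    (alpha beta : R * R -> R -> R -> R -> R) :
  0 < g ->
  smooth_domain Omega ->
  bdry_param Omega gamma ->
  outward_unit_normal Omega gamma n ->
  (0 < T)%E ->
  smooth_upto (spacetime T Omega) (fun z => h z.1 z.2) ->
  smooth_upto (spacetime T Omega) (fun z => u z.1 z.2) ->
  smooth_upto (spacetime T Omega) (fun z => v z.1 z.2) ->
  (forall (t : R) p, 0 <= t -> (t%:E < T)%E -> Omega p -> 0 < h t p) ->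
  (forall (t : R) p, 0 <= t -> (t%:E < T)%E -> Omega p ->
     enorm (u t p, v t p) < Num.sqrt (g * h t p)) ->
  (forall (t : R) p, 0 < t -> (t%:E < T)%E -> Omega p -> sw_eqs g fc h u v t p) ->
  (forall p, Omega p -> [/\ h 0 p = h0 p, u 0 p = u0 p & v 0 p = v0 p]) ->
  (forall (t : R) p, 0 < t -> (t%:E < T)%E -> bdry Omega p ->
     bdry_cond g (alpha p (h t p) (u t p) (v t p)) (beta p (h t p) (u t p) (v t p))
       (n p) (h t p) (u t p) (v t p)) ->
  (forall (t : R) p, 0 < t -> (t%:E < T)%E -> bdry Omega p ->
     let a := alpha p (h t p) (u t p) (v t p) in
     let b := beta p (h t p) (u t p) (v t p) in
     [/\ 0 <= a, 0 <= b & 0 < `|a| ^+ 2 + `|b| ^+ 2]) ->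
  (forall (t : R), 0 < t -> (t%:E < T)%E ->
     is_derive t 1 (energy g Omega h u v) (bdry_term g gamma n h u v t) /\
     bdry_term g gamma n h u v t <= 0) /\
  (forall (t : R), 0 <= t -> (t%:E < T)%E ->
     energy g Omega h u v t <= energy g Omega h u v 0).
Proof.
move=> g0 [_ Oopen _ Obounded Obdry] bp nu _ [] U1 [] H [] o1 S1 HC Hh
  [] U2 [] A [] o2 S2 AC Au [] U3 [] B [] o3 S3 BC Bv hpos _ sw _ bc ab.
(* The three fields extend to separate neighbourhoods; the argument runs on the common one. *)
pose U := U1 `&` (U2 `&` U3).
have oU : open U by apply: openI => //; exact: openI.
have SU : spacetime T Omega `<=` U.
  by move=> z Sz; split; [exact: S1|split; [exact: S2|exact: S3]].
have HU : class_C 1 U H by apply: class_C1_subset (HC 1%N) => z [].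
have AU : class_C 1 U A by apply: class_C1_subset (AC 1%N) => z [_ []].
have BU : class_C 1 U B by apply: class_C1_subset (BC 1%N) => z [_ []].
have dE (t : R) : 0 < t -> (t%:E < T)%E ->
    is_derive t 1 (extended_energy g Omega H A B) (bdry_term g gamma n h u v t).
  move=> t0 tT.
  rewrite -(bdry_term_extended Oopen Obounded Obdry bp nu sw oU SU HU AU BU Hh Au Bv t0 tT).
  exact: (extended_energy_derive g Oopen Obounded oU SU HU AU BU (ltW t0) tT).
have hge0 (t : R) p : 0 <= t -> (t%:E < T)%E -> closure Omega p -> 0 <= h t p.
  move=> t0 tT Cp; rewrite -(Hh (t, p))//.
  apply: (@closure_ge0 _ _ Omega (fun q => H (t, q))) => // [q Cq|q Oq].
    by apply: class_C1_cont (class_C1_slice t oU HU) _; exact: SU.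
  by rewrite (Hh (t, q)) ?ltW ?hpos//; split => //; exact: subset_closure.
have le0 (t : R) : 0 < t -> (t%:E < T)%E -> bdry_term g gamma n h u v t <= 0.
  move=> t0 tT; apply: bdry_term_le0 => i s p pE.
  have bp' : bdry Omega p by rewrite pE; exact: bdry_param_bdry.
  have [a0 b0 ab0] := ab t p t0 tT bp'.
  apply: bdry_flux_ge0 a0 b0 ab0 (bc t p t0 tT bp') => //.
  by apply: hge0 (ltW t0) tT _; case: bp'.
have eE (t : R) : 0 <= t -> (t%:E < T)%E ->
    energy g Omega h u v t = extended_energy g Omega H A B t.
  exact: (extended_energyE g Hh Au Bv).
split=> t t0 tT.
  split; last exact: le0.
  apply: near_eq_is_derive (dE t t0 tT); near=> s; apply/esym/eE.
    by apply: ltW; near: s; exact: lt_nbhsr.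
  by near: s; exact: near_lt_ereal.
have sT (s : R) : s <= t -> (s%:E < T)%E.
  by move=> st; apply: le_lt_trans tT; rewrite lee_fin.
rewrite !eE// ?sT//.
(* The mean value theorem needs continuity up to 0, supplied by the extension, while the sign of the
   derivative is known at positive times only. *)
have dcc : {in `[0, t], forall s, derivable (extended_energy g Omega H A B) s 1}.
  move=> s; rewrite in_itv/= => /andP[s0 st].
  by have [] := extended_energy_derive g Oopen Obounded oU SU HU AU BU s0 (sT s st).
have doo s : s \in `]0, t[ ->
    is_derive s 1 (extended_energy g Omega H A B) (bdry_term g gamma n h u v s).
  by rewrite in_itv/= => /andP[s0 st]; apply: dE => //; apply/sT/ltW.
have [->//|tN0] := eqVneq t 0.
have tp : 0 < t by rewrite lt0r tN0.
have [c cI E] := MVT tp doo (derivable_within_continuous dcc).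
move: cI; rewrite in_itv/= => /andP[c0 ct].
rewrite -subr_le0 E subr0 mulr_le0_ge0//.
by apply: le0 => //; apply/sT/ltW.
Unshelve. all: by end_near. Qed.
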